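(* Let $\mathcal A$ be a finitely complete DG-category. Then $(H^0(\mathcal A),\Omega,\Delta)$ is a left triangulated category, where $\Omega$ is the loop functor and $\Delta$ is the class of all triangles in $H^0(\mathcal A)$ isomorphic to standard left triangles.
   Context: **DG-categories.** Let $k$ be a commutative ring. DG-categories are $k$-linear with cohomological grading (differential $d$ of degree $+1$). All DG-categories $\mathcal A$ are assumed non-positive: $\mathcal A(X,Y)^i=0$ for $i>0$. A morphism $f$ is closed if $d(f)=0$. $H^0(\mathcal A)$ is the homotopy category. **Exactness.** For a chain map $\varphi:M\to N$ let $\mathrm{Fib}(\varphi)=\mathrm{Cone}(\varphi)[-1]$ be the complex $\mathrm{Fib}(\varphi)^i=M^i\oplus N^{i-1}$, $d(m,h)=(dm,-\varphi(m)-dh)$. A 3-term homotopy complex $(f,g,h)$ consists of closed degree-$0$ morphisms $f:X\to Y$, $g:Y\to Z$ and a degree $-1$ morphism $h:X\to Z$ with $d(h)=-g\circ f$. It is left exact (a homotopy kernel of $g$) if for every object $W$ and every $i\le 0$ the chain map $\mathcal A(W,X)\to \mathrm{Fib}(g\circ-:\mathcal A(W,Y)\to\mathcal A(W,Z))$, $u\mapsto (f\circ u,h\circ u)$, induces an isomorphism on $H^i$. $\mathcal A$ is finitely complete if $H^0(\mathcal A)$ is additive and every closed degree-$0$ morphism has a homotopy kernel. **Loops.** A loop object of $X$ is a pair $(\Omega X,h_X)$ with $h_X:\Omega X\to X$ closed of degree $-1$ such that $h_X\circ-:H^i(\mathcal A(W,\Omega X))\to H^{i-1}(\mathcal A(W,X))$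 is an isomorphism for all $W$ and $i\le 0$. In a finitely complete DG-category they exist for all objects. The functor $\Omega:H^0(\mathcal A)\to H^0(\mathcal A)$ is given on $f:X\to Y$ by: $\Omega f$ is the unique class $f':\Omega X\to\Omega Y$ for which there is a degree $-2$ morphism $t$ with $d(t)=h_Y\circ f'-f\circ h_X$. **Standard left triangles.** A standard left triangle for $f_0:A_1\to A_0$ (closed of degree $0$) is the diagram $\Omega A_0\xrightarrow{f_2}A_2\xrightarrow{f_1}A_1\xrightarrow{f_0}A_0$ in $H^0(\mathcal A)$, where $(f_1,f_0,h_{f_0})$ is left exact and $f_2$ is closed of degree $0$ such that there exist $h_{f_1}:\Omega A_0\to A_1$ of degree $-1$ with $d(h_{f_1})=-f_1\circ f_2$ and $\eta:\Omega A_0\to A_0$ of degree $-2$ with $d(\eta)=f_0\circ h_{f_1}-h_{f_0}\circ f_2-h_{A_0}$ (then $(f_2,f_1,h_{f_1})$ is also left exact). **Left triangulated categories.** Let $\mathcal C$ be additive, $\Omega:\mathcal C\to\mathcal C$ an additive functor, and $\Delta$ a class of diagrams (''triangles'') $\Omega A\to C\to B\to A$ closed under isomorphism (a morphism of triangles is a triple $(\gamma,\beta,\alpha)$ which together with $\Omega\alpha$ makes all squares commute). $(\mathcal C,\Omega,\Delta)$ is left triangulated if: (LT1) $0\to A= A\to0$ is in $\Delta$ for every $A$, and every $f:B\to A$ fits into some $\Omega A\to C\to B\xrightarrow{f}A$ in $\Delta$. (LT2) If $\Omega A\xrightarrow{h}C\xrightarrow{g}B\xrightarrow{f}A$ is in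 $\Delta$, so is $\Omega B\xrightarrow{-\Omega f}\Omega A\xrightarrow{h}C\xrightarrow{g}B$. (LT3) Given two triangles in $\Delta$ and $(\beta,\alpha)$ making the rightmost square commute, there is $\gamma$ such that $(\gamma,\beta,\alpha)$ is a morphism of triangles. (LT4) Given $\Omega A\xrightarrow{f''}F\xrightarrow{f'}B\xrightarrow{f}A$ and $\Omega B\xrightarrow{g''}E\xrightarrow{g'}C\xrightarrow{g}B$ in $\Delta$, there are triangles $\Omega A\xrightarrow{v''}D\xrightarrow{v'}C\xrightarrow{f\circ g}A$ and $\Omega F\xrightarrow{u''}E\xrightarrow{u'}D\xrightarrow{u}F$ in $\Delta$ with $v'u'=g'$, $f'u=gv'$, $uv''=f''$, $u''=g''\circ\Omega f'$, $u'g''=v''\circ\Omega f$. *)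

(* Defs.v *)
From HB Require Import structures.
From mathcomp Require Import all_boot all_order all_algebra.
From mathcomp Require Import boolp.

Set Implicit Arguments.
Unset Strict Implicit.
Unset Printing Implicit Defensive.

Import Order.TTheory GRing.Theory Num.Theory.

Local Open Scope ring_scope.
Local Open Scope quotient_scope.

(* Degrees are integers, and an operation landing in degree n takes a proof
   that n is the expected degree.  No transport along an equality of degrees is
   then needed in the axioms (equality of integers is proof-irrelevant). *)

Record complex (k : comPzRingType) := Complex {
  cterm :> int -> lmodType k;
  cdiff : forall i j : int, j = i + 1 -> {linear cterm i -> cterm j};
  cdiff_cdiff : forall (i j l : int) (e : j = i + 1) (e' : l = j + 1)
    (x : cterm i), cdiff e' (cdiff e x) = 0
}.
Arguments cdiff {k} c {i j} e.

Section Cohomology.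
Variables (k : comPzRingType) (C : complex k) (i : int).

Definition is_cycle : {pred C i} := [pred x | cdiff C (erefl (i + 1)) x == 0].

Fact is_cycle_zmod_closed : zmod_closed is_cycle.
Proof.
split=> [|x y]; rewrite !inE ?raddf0 // => /eqP dx /eqP dy.
by rewrite raddfB /= dx dy subrr.
Qed.
HB.instance Definition _ :=
  GRing.isZmodClosed.Build (C i) is_cycle is_cycle_zmod_closed.

Record cycle := Cycle { cycle_val :> C i; _ : cycle_val \in is_cycle }.
HB.instance Definition _ := [isSub for cycle_val].
HB.instance Definition _ := [Choice of cycle by <:].
HB.instance Definition _ := [SubChoice_isSubZmodule of cycle by <:].

Definition is_boundary : {pred cycle} :=
  [pred z : cycle | `[< exists (j : int) (e : i = j + 1) (y : C j),
                          val z = cdiff C e y >]].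

Fact is_boundary_zmod_closed : zmod_closed is_boundary.
Proof.
split=> [|x y].
  have e : i = (i - 1) + 1 by rewrite subrK.
  by rewrite inE; apply/asboolP; exists (i - 1), e, 0; rewrite !raddf0.
move=> /asboolP[j [e [u xE]]] /asboolP[j' [e' [v yE]]]; apply/asboolP.
have jj' : j' = j by apply: (addIr 1); rewrite -e -e'.
subst j'; exists j, e, (u - v).
by rewrite !raddfB /= xE yE (eq_irrelevance e' e).
Qed.
HB.instance Definition _ :=
  GRing.isZmodClosed.Build cycle is_boundary is_boundary_zmod_closed.

Definition cohomology : zmodType := Quotient.quot is_boundary.

Definition cls (z : cycle) : cohomology := \pi z.

Lemma cycleP (z : cycle) j (e : j = i + 1) : cdiff C e (val z) = 0.
Proof. by subst j; apply/eqP/(valP z). Qed.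

Lemma clsP (z w : cycle) :
  cls z = cls w <->
  exists (j : int) (e : i = j + 1) (y : C j), val z - val w = cdiff C e y.
Proof.
rewrite /cls; split=> [/eqP|zw].
  by rewrite -Quotient.idealrBE => /asboolP[j [e [y yE]]]; exists j, e, y;
     rewrite -yE raddfB.
apply/eqP; rewrite -Quotient.idealrBE; apply/asboolP.
by case: zw => j [e [y yE]]; exists j, e, y; rewrite raddfB.
Qed.

Lemma cls_zmod_morphism : zmod_morphism cls.
Proof. exact: raddfB. Qed.

Lemma cls_repr (a : cohomology) : cls (repr a) = a.
Proof. exact: reprK. Qed.

End Cohomology.

HB.instance Definition _ k (C : complex k) i :=
  GRing.isZmodMorphism.Build (cycle C i) (cohomology C i) (@cls k C i)
    (@cls_zmod_morphism k C i).

Definition mkcycle k (C : complex k) i (x : C i)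
    (dx : cdiff C (erefl (i + 1)) x = 0) : cycle C i :=
  @Cycle k C i x (introT eqP dx).

Record chain_map (k : comPzRingType) (C D : complex k) := ChainMap {
  cmap :> forall i : int, {linear C i -> D i};
  cmap_cdiff : forall (i j : int) (e : j = i + 1) (x : C i),
    cmap j (cdiff C e x) = cdiff D e (cmap i x)
}.

Section InducedMap.
Variables (k : comPzRingType) (C D : complex k) (phi : chain_map C D) (i : int).

Fact cycle_map_subproof (z : cycle C i) :
  cdiff D (erefl (i + 1)) (phi i (val z)) = 0.
Proof. by rewrite -cmap_cdiff cycleP raddf0. Qed.

Definition cycle_map (z : cycle C i) : cycle D i :=
  mkcycle (cycle_map_subproof z).

Definition cohomology_map (a : cohomology C i) : cohomology D i :=
  cls (cycle_map (repr a)).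

Lemma cohomology_mapE (z : cycle C i) :
  cohomology_map (cls z) = cls (cycle_map z).
Proof.
rewrite /cohomology_map; apply/clsP => /=.
have /clsP[j [e [y yE]]] := cls_repr (cls z).
by exists j, e, (phi j y); rewrite -cmap_cdiff -yE raddfB.
Qed.

End InducedMap.

Section Fiber.
Variables (k : comPzRingType) (M N : complex k) (phi : chain_map M N).

Definition ctransport (C : complex k) (i j : int) (e : i = j) (x : C i) : C j :=
  eq_rect i (fun n => C n : Type) x j e.

Fact ctransport_linear C i j e : linear (@ctransport C i j e).
Proof. by case: j / e. Qed.
HB.instance Definition _ (C : complex k) (i j : int) (e : i = j) :=
  GRing.isLinear.Build k (C i) (C j) _ (@ctransport C i j e)
    (@ctransport_linear C i j e).

Definition fib_term (i : int) : lmodType k := (M i * N (i - 1))%type.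

Fact fib_deg1 (i j : int) (e : j = i + 1) : i = j - 1.
Proof. by rewrite e addrK. Qed.
Fact fib_deg2 (i j : int) (e : j = i + 1) : j - 1 = i - 1 + 1.
Proof. by rewrite e addrK subrK. Qed.

Definition fib_diff (i j : int) (e : j = i + 1) (x : fib_term i) : fib_term j :=
  (cdiff M e x.1,
   - ctransport (fib_deg1 e) (phi i x.1) - cdiff N (fib_deg2 e) x.2).

Fact fib_diff_linear i j e : linear (@fib_diff i j e).
Proof.
move=> a x y; rewrite /fib_diff; congr (_, _); rewrite /= !linearP //=.
by rewrite scalerDr addrACA.
Qed.
HB.instance Definition _ (i j : int) (e : j = i + 1) :=
  GRing.isLinear.Build k (fib_term i) (fib_term j) _ (@fib_diff i j e)
    (@fib_diff_linear i j e).

Lemma cdiff_ctransport (C : complex k) (i i' j j' : int) (p : i = i')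
    (q : j = j') (e : j = i + 1) (e' : j' = i' + 1) (x : C i) :
  cdiff C e' (ctransport p x) = ctransport q (cdiff C e x).
Proof. by case: i' / p e'; case: j' / q => e'; rewrite (eq_irrelevance e' e). Qed.

Fact fib_diff_diff i j l (e : j = i + 1) (e' : l = j + 1) (x : fib_term i) :
  fib_diff e' (fib_diff e x) = 0.
Proof.
rewrite /fib_diff /= cdiff_cdiff; congr (_, _).
rewrite raddfB raddfN /= cdiff_cdiff subr0 opprK cmap_cdiff.
by rewrite (cdiff_ctransport _ (fib_deg1 e') e) addNr.
Qed.

Definition fib : complex k :=
  @Complex k fib_term (fun i j e => fib_diff e : {linear _ -> _}) fib_diff_diff.

End Fiber.

(* comp e g f is the composite of f followed by g. *)
Record dg_category (k : comPzRingType) := DGCategory {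
  dg_ob :> Type;
  dg_hom : dg_ob -> dg_ob -> complex k;
  dg_id : forall X, dg_hom X X 0;
  dg_comp : forall X Y Z (i j n : int), n = i + j ->
    dg_hom Y Z i -> dg_hom X Y j -> dg_hom X Z n;
  dg_comp_linearr : forall X Y Z (i j n : int) (e : n = i + j)
    (g : dg_hom Y Z i), linear (@dg_comp X Y Z i j n e g);
  dg_comp_linearl : forall X Y Z (i j n : int) (e : n = i + j)
    (f : dg_hom X Y j), linear (fun g : dg_hom Y Z i => dg_comp e g f);
  dg_comp_id_l : forall X Y (j : int) (e : j = 0 + j) (f : dg_hom X Y j),
    dg_comp e (dg_id Y) f = f;
  dg_comp_id_r : forall X Y (i : int) (e : i = i + 0) (g : dg_hom X Y i),
    dg_comp e g (dg_id X) = g;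
  dg_comp_assoc : forall X Y Z T (i j l ij jl n : int)
    (e1 : n = ij + l) (e2 : ij = i + j) (e3 : n = i + jl) (e4 : jl = j + l)
    (h : dg_hom Z T i) (g : dg_hom Y Z j) (f : dg_hom X Y l),
    dg_comp e1 (dg_comp e2 h g) f = dg_comp e3 h (dg_comp e4 g f);
  dg_id_closed : forall X (j : int) (e : j = 0 + 1), cdiff (dg_hom X X) e (dg_id X) = 0;
  dg_leibniz : forall X Y Z (i j n i1 j1 n1 : int)
    (e : n = i + j) (en : n1 = n + 1) (ei : i1 = i + 1) (ej : j1 = j + 1)
    (e1 : n1 = i1 + j) (e2 : n1 = i + j1)
    (g : dg_hom Y Z i) (f : dg_hom X Y j),
    cdiff (dg_hom X Z) en (dg_comp e g f) =
      dg_comp e1 (cdiff (dg_hom Y Z) ei g) f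
      + (-1) ^+ `|i|%N *: dg_comp e2 g (cdiff (dg_hom X Y) ej f)
}.
Arguments dg_hom {k} d X Y.
Arguments dg_id {k d} X.
Arguments dg_comp {k d X Y Z i j n} e g f.

HB.instance Definition _ k (A : dg_category k) (X Y Z : A) (i j n : int)
    (e : n = i + j) (g : dg_hom A Y Z i) :=
  GRing.isLinear.Build k (dg_hom A X Y j) (dg_hom A X Z n) _
    (@dg_comp k A X Y Z i j n e g) (dg_comp_linearr e g).

Definition nonpositive k (A : dg_category k) : Prop :=
  forall (X Y : A) (i : int) (f : dg_hom A X Y i), 0 < i -> f = 0.

Definition closed_hom k (A : dg_category k) (X Y : A) (i : int) : zmodType :=
  cycle (dg_hom A X Y) i.

Definition hohom k (A : dg_category k) (X Y : A) (i : int) : zmodType :=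
  cohomology (dg_hom A X Y) i.

Section DGTheory.
Variables (k : comPzRingType) (A : dg_category k).
Implicit Types X Y Z W : A.

Lemma dg_compBl X Y Z i j n (e : n = i + j) (g g' : dg_hom A Y Z i)
    (f : dg_hom A X Y j) :
  dg_comp e (g - g') f = dg_comp e g f - dg_comp e g' f.
Proof.
by have := dg_comp_linearl e f (-1) g' g; rewrite !scaleN1r ![- _ + _]addrC.
Qed.

Lemma dg_compDl X Y Z i j n (e : n = i + j) (g g' : dg_hom A Y Z i)
    (f : dg_hom A X Y j) :
  dg_comp e (g + g') f = dg_comp e g f + dg_comp e g' f.
Proof. by have := dg_comp_linearl e f 1 g g'; rewrite !scale1r. Qed.

Lemma dg_comp0l X Y Z i j n (e : n = i + j) (f : dg_hom A X Y j) :
  dg_comp e (0 : dg_hom A Y Z i) f = 0.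
Proof. by rewrite -(subrr (0 : dg_hom A Y Z i)) dg_compBl subrr. Qed.

Lemma dg_compNl X Y Z i j n (e : n = i + j) (g : dg_hom A Y Z i)
    (f : dg_hom A X Y j) : dg_comp e (- g) f = - dg_comp e g f.
Proof. by rewrite -sub0r dg_compBl dg_comp0l sub0r. Qed.

Fact closed_comp_subproof X Y Z i j n (e : n = i + j)
    (g : closed_hom Y Z i) (f : closed_hom X Y j) :
  cdiff (dg_hom A X Z) (erefl (n + 1)) (dg_comp e (val g) (val f)) = 0.
Proof.
have e1 : n + 1 = (i + 1) + j by rewrite e addrAC.
have e2 : n + 1 = i + (j + 1) by rewrite e addrA.
by rewrite (dg_leibniz _ _ erefl erefl e1 e2) !cycleP dg_comp0l raddf0 scaler0 addr0.
Qed.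

Definition closed_comp X Y Z i j n (e : n = i + j)
    (g : closed_hom Y Z i) (f : closed_hom X Y j) : closed_hom X Z n :=
  mkcycle (closed_comp_subproof e g f).

Definition closed_id X : closed_hom X X 0 := mkcycle (dg_id_closed X erefl).

(* Composition in the graded homotopy category. *)
Definition hocomp X Y Z i j n (e : n = i + j)
    (b : hohom Y Z i) (a : hohom X Y j) : hohom X Z n :=
  cls (closed_comp e (repr b) (repr a)).

Lemma hocompE X Y Z i j n (e : n = i + j)
    (g : closed_hom Y Z i) (f : closed_hom X Y j) :
  hocomp e (cls g) (cls f) = cls (closed_comp e g f).
Proof.
have [p [ep [y yE]]] := (clsP _ _).1 (cls_repr (cls g)).
have [q [eq [x xE]]] := (clsP _ _).1 (cls_repr (cls f)).
rewrite /hocomp; set g' := repr _ in yE *; set f' := repr _ in xE *.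
transitivity (cls (closed_comp e g f')).
  have e0 : n = (p + j) + 1 by rewrite e ep addrAC.
  have e2 : n = p + (j + 1) by rewrite e ep -addrA (addrC 1).
  apply/clsP; exists (p + j), e0, (dg_comp erefl y (val f')).
  rewrite (dg_leibniz _ _ ep erefl e e2) cycleP raddf0 scaler0 addr0.
  by rewrite -yE dg_compBl.
have e0 : n = (i + q) + 1 by rewrite e eq addrA.
have e1 : n = (i + 1) + q by rewrite e0 addrAC.
apply/clsP; exists (i + q), e0, ((-1) ^+ `|i|%N *: dg_comp erefl (val g) x).
rewrite linearZ /= (dg_leibniz _ _ erefl eq e1 e) cycleP dg_comp0l add0r.
by rewrite scalerA -exprMn mulrNN mulr1 expr1n scale1r -xE raddfB.
Qed.

Lemma dg_comp_eq X Y Z i j n (e e' : n = i + j) (g : dg_hom A Y Z i)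
    (f : dg_hom A X Y j) : dg_comp e g f = dg_comp e' g f.
Proof. by rewrite (eq_irrelevance e e'). Qed.

Fact postcomp_deg (i : int) : i = 0 + i. Proof. by rewrite add0r. Qed.

Section Postcomposition.
Variables (Y Z : A) (g : closed_hom Y Z 0) (W : A).

Definition postcomp_fun (i : int) (u : dg_hom A W Y i) : dg_hom A W Z i :=
  dg_comp (postcomp_deg i) (val g) u.
HB.instance Definition _ (i : int) := GRing.isLinear.Build k (dg_hom A W Y i)
  (dg_hom A W Z i) _ (@postcomp_fun i)
  (dg_comp_linearr (postcomp_deg i) (val g)).

Fact postcomp_cdiff (i j : int) (e : j = i + 1) (u : dg_hom A W Y i) :
  postcomp_fun (cdiff _ e u) = cdiff _ e (postcomp_fun u).
Proof.
have e1 : j = 1 + i by rewrite addrC.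
rewrite /postcomp_fun (dg_leibniz _ e (erefl : 1 = 0 + 1 :> int) e e1 (postcomp_deg j)).
by rewrite cycleP dg_comp0l add0r expr0 scale1r.
Qed.

Definition postcomp : chain_map (dg_hom A W Y) (dg_hom A W Z) :=
  @ChainMap k _ _ (fun i => @postcomp_fun i : {linear _ -> _}) postcomp_cdiff.

End Postcomposition.

Definition homotopy_complex X Y Z (f : closed_hom X Y 0) (g : closed_hom Y Z 0)
    (h : dg_hom A X Z (-1)) : Prop :=
  cdiff _ (erefl : 0 = -1 + 1 :> int) h =
  - dg_comp (erefl : 0 = 0 + 0 :> int) (val g) (val f).

Fact kernel_deg (i : int) : i - 1 = -1 + i. Proof. by rewrite addrC. Qed.

Section KernelMap.
Variables (X Y Z : A) (f : closed_hom X Y 0) (g : closed_hom Y Z 0).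
Variables (h : dg_hom A X Z (-1)) (hP : homotopy_complex f g h) (W : A).

Definition kernel_map_fun (i : int) (u : dg_hom A W X i) :
    fib (postcomp g W) i :=
  (postcomp f W i u, dg_comp (kernel_deg i) h u).

Fact kernel_map_linear i : linear (@kernel_map_fun i).
Proof. by move=> a u v; rewrite /kernel_map_fun !linearP. Qed.
HB.instance Definition _ (i : int) := GRing.isLinear.Build k (dg_hom A W X i)
  (fib (postcomp g W) i) _ (@kernel_map_fun i) (@kernel_map_linear i).

Lemma ctransport_comp (T U V : A) i j n n' (p : n = n') (e : n = i + j)
    (e' : n' = i + j) (b : dg_hom A U V i) (a : dg_hom A T U j) :
  ctransport p (dg_comp e b a) = dg_comp e' b a.
Proof. by case: n' / p e' => e'; exact: dg_comp_eq. Qed.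

Fact kernel_map_cdiff (i j : int) (e : j = i + 1) (u : dg_hom A W X i) :
  kernel_map_fun (cdiff _ e u) =
  cdiff (fib (postcomp g W)) e (kernel_map_fun u).
Proof.
rewrite /kernel_map_fun /= /fib_diff /= postcomp_cdiff; congr (_, _).
have e0 : j - 1 = 0 + i by rewrite e addrK add0r.
have e1 : j - 1 = -1 + j by rewrite addrC.
rewrite (dg_leibniz _ (fib_deg2 e) (erefl : 0 = -1 + 1 :> int) e e0 e1) hP.
rewrite expr1 scaleN1r opprD opprK dg_compNl opprK.
rewrite /postcomp_fun (ctransport_comp _ _ e0).
rewrite (dg_comp_assoc e0 (erefl : 0 = 0 + 0 :> int) e0 (postcomp_deg i)).
by rewrite addKr; exact: dg_comp_eq.
Qed.

Definition kernel_map : chain_map (dg_hom A W X) (fib (postcomp g W)) :=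
  @ChainMap k _ _ (fun i => @kernel_map_fun i : {linear _ -> _})
    kernel_map_cdiff.

End KernelMap.

Definition left_exact X Y Z (f : closed_hom X Y 0) (g : closed_hom Y Z 0)
    (h : dg_hom A X Z (-1)) : Prop :=
  exists hP : homotopy_complex f g h,
  forall (W : A) (i : int), i <= 0 ->
    bijective (cohomology_map (kernel_map hP W) (i := i)).

End DGTheory.

Record preadditive := Preadditive {
  pa_ob :> Type;
  pa_hom : pa_ob -> pa_ob -> zmodType;
  pa_id : forall X, pa_hom X X;
  pa_comp : forall X Y Z, pa_hom Y Z -> pa_hom X Y -> pa_hom X Z;
  pa_comp_id_l : forall X Y (f : pa_hom X Y), pa_comp (pa_id Y) f = f;
  pa_comp_id_r : forall X Y (f : pa_hom X Y), pa_comp f (pa_id X) = f;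
  pa_comp_assoc : forall X Y Z T (h : pa_hom Z T) (g : pa_hom Y Z)
    (f : pa_hom X Y), pa_comp (pa_comp h g) f = pa_comp h (pa_comp g f);
  pa_compDl : forall X Y Z (g g' : pa_hom Y Z) (f : pa_hom X Y),
    pa_comp (g + g') f = pa_comp g f + pa_comp g' f;
  pa_compDr : forall X Y Z (g : pa_hom Y Z) (f f' : pa_hom X Y),
    pa_comp g (f + f') = pa_comp g f + pa_comp g f'
}.
Arguments pa_hom {p} X Y.
Arguments pa_id {p} X.
Arguments pa_comp {p X Y Z} g f.

Declare Scope pa_scope.
Notation "g \c f" := (pa_comp g f) (at level 40, left associativity) : pa_scope.
Local Open Scope pa_scope.

Section PreadditiveTheory.
Variable C : preadditive.
Implicit Types X Y Z : C.

Definition zero_object Z : Prop :=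
  forall X, (forall f : pa_hom Z X, f = 0) /\ (forall f : pa_hom X Z, f = 0).

Definition has_biproduct X Y : Prop :=
  exists (P : C) (i1 : pa_hom X P) (i2 : pa_hom Y P)
         (p1 : pa_hom P X) (p2 : pa_hom P Y),
    [/\ p1 \c i1 = pa_id X, p2 \c i2 = pa_id Y, p1 \c i2 = 0, p2 \c i1 = 0
      & i1 \c p1 + i2 \c p2 = pa_id P].

Definition additive_category : Prop :=
  (exists Z : C, zero_object Z) /\ (forall X Y : C, has_biproduct X Y).

Definition pa_iso X Y (f : pa_hom X Y) : Prop :=
  exists g : pa_hom Y X, g \c f = pa_id X /\ f \c g = pa_id Y.

End PreadditiveTheory.

(* The data of an endofunctor; the axioms are in additive_functor. *)
Record endofunctor (C : preadditive) := Endofunctor {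
  fob :> C -> C;
  fmap : forall X Y : C, pa_hom X Y -> pa_hom (fob X) (fob Y)
}.
Arguments fmap {C} e {X Y} f.

Definition additive_functor (C : preadditive) (F : endofunctor C) : Prop :=
  [/\ forall X : C, fmap F (pa_id X) = pa_id (F X),
      forall (X Y Z : C) (g : pa_hom Y Z) (f : pa_hom X Y),
        fmap F (g \c f) = fmap F g \c fmap F f
    & forall (X Y : C) (f g : pa_hom X Y),
        fmap F (f + g) = fmap F f + fmap F g].

Section LeftTriangulated.
Variables (C : preadditive) (Om : endofunctor C).

(* Triangle h g f is the diagram  Om A --h--> C --g--> B --f--> A. *)
Record triangle := Triangle {
  tri_A : C; tri_B : C; tri_C : C;
  tri_h : pa_hom (Om tri_A) tri_C;
  tri_g : pa_hom tri_C tri_B;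
  tri_f : pa_hom tri_B tri_A
}.

Definition triangle_morphism (S T : triangle)
    (c : pa_hom (tri_C S) (tri_C T)) (b : pa_hom (tri_B S) (tri_B T))
    (a : pa_hom (tri_A S) (tri_A T)) : Prop :=
  [/\ c \c tri_h S = tri_h T \c fmap Om a,
      b \c tri_g S = tri_g T \c c
    & a \c tri_f S = tri_f T \c b].

(* Om a is invertible whenever a is, Om being a functor. *)
Definition triangle_iso (S T : triangle) : Prop :=
  exists (c : pa_hom (tri_C S) (tri_C T)) (b : pa_hom (tri_B S) (tri_B T))
         (a : pa_hom (tri_A S) (tri_A T)),
    [/\ triangle_morphism c b a, pa_iso c, pa_iso b & pa_iso a].

Variable Delta : triangle -> Prop.

Record left_triangulated : Prop := LeftTriangulated {
  lt_additive : additive_category C;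
  lt_functor : additive_functor Om;
  lt_iso_closed : forall S T : triangle,
    triangle_iso S T -> Delta S -> Delta T;
  lt1_id : forall Z A : C, zero_object Z ->
    Delta (@Triangle Z A A 0 (pa_id A) 0);
  lt1_ex : forall (B A : C) (f : pa_hom B A),
    exists (D : C) (h : pa_hom (Om A) D) (g : pa_hom D B),
      Delta (Triangle h g f);
  lt2 : forall (A B D : C) (h : pa_hom (Om A) D) (g : pa_hom D B)
    (f : pa_hom B A),
    Delta (Triangle h g f) -> Delta (Triangle (- fmap Om f) h g);
  lt3 : forall (S T : triangle)
    (b : pa_hom (tri_B S) (tri_B T)) (a : pa_hom (tri_A S) (tri_A T)),
    Delta S -> Delta T -> a \c tri_f S = tri_f T \c b ->
    exists c : pa_hom (tri_C S) (tri_C T), triangle_morphism c b a;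
  lt4 : forall (A B X E F : C)
    (f'' : pa_hom (Om A) F) (f' : pa_hom F B) (f : pa_hom B A)
    (g'' : pa_hom (Om B) E) (g' : pa_hom E X) (g : pa_hom X B),
    Delta (Triangle f'' f' f) -> Delta (Triangle g'' g' g) ->
    exists (D : C)
      (v'' : pa_hom (Om A) D) (v' : pa_hom D X)
      (u'' : pa_hom (Om F) E) (u' : pa_hom E D) (u : pa_hom D F),
      [/\ Delta (Triangle v'' v' (f \c g)), Delta (Triangle u'' u' u)
        & [/\ v' \c u' = g', f' \c u = g \c v', u \c v'' = f'',
              u'' = g'' \c fmap Om f' & u' \c g'' = v'' \c fmap Om f]]
}.

End LeftTriangulated.

Section HomotopyCategory.
Variables (k : comPzRingType) (A : dg_category k).

Let comp0 (X Y Z : A) (b : hohom Y Z 0) (a : hohom X Y 0) : hohom X Z 0 :=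
  hocomp (erefl : 0 = 0 + 0 :> int) b a.

Let id0 (X : A) : hohom X X 0 := cls (closed_id X).

Fact ho_comp_id_l X Y (f : hohom X Y 0) : comp0 (id0 Y) f = f.
Proof.
rewrite -(cls_repr f) /comp0 hocompE; congr cls.
by apply: val_inj; rewrite /= dg_comp_id_l.
Qed.

Fact ho_comp_id_r X Y (f : hohom X Y 0) : comp0 f (id0 X) = f.
Proof.
rewrite -(cls_repr f) /comp0 hocompE; congr cls.
by apply: val_inj; rewrite /= dg_comp_id_r.
Qed.

Fact ho_comp_assoc X Y Z T (h : hohom Z T 0) (g : hohom Y Z 0)
  (f : hohom X Y 0) : comp0 (comp0 h g) f = comp0 h (comp0 g f).
Proof.
rewrite -(cls_repr f) -(cls_repr g) -(cls_repr h) /comp0 !hocompE; congr cls.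
by apply: val_inj; exact: dg_comp_assoc.
Qed.

Fact ho_compDl X Y Z (g g' : hohom Y Z 0) (f : hohom X Y 0) :
  comp0 (g + g') f = comp0 g f + comp0 g' f.
Proof.
rewrite -(cls_repr f) -(cls_repr g) -(cls_repr g') -raddfD /comp0 !hocompE.
by rewrite -raddfD; congr cls; apply: val_inj; rewrite /= dg_compDl.
Qed.

Fact ho_compDr X Y Z (g : hohom Y Z 0) (f f' : hohom X Y 0) :
  comp0 g (f + f') = comp0 g f + comp0 g f'.
Proof.
rewrite -(cls_repr f) -(cls_repr g) -(cls_repr f') -raddfD /comp0 !hocompE.
by rewrite -raddfD; congr cls; apply: val_inj; rewrite /= raddfD.
Qed.

Definition H0 : preadditive :=
  @Preadditive A (fun X Y => hohom X Y 0) id0 comp0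
    ho_comp_id_l ho_comp_id_r ho_comp_assoc ho_compDl ho_compDr.

Definition finitely_complete : Prop :=
  additive_category H0 /\
  forall (Y Z : A) (g : closed_hom Y Z 0),
    exists (X : A) (f : closed_hom X Y 0) (h : dg_hom A X Z (-1)),
      left_exact f g h.

Record loop_object (X : A) := LoopObject {
  loop_ob : A;
  loop_hom : closed_hom loop_ob X (-1);
  loop_bij : forall (W : A) (i n : int) (e : n = -1 + i), i <= 0 ->
    bijective (hocomp e (cls loop_hom) : hohom W loop_ob i -> hohom W X n)
}.

Definition loop_map_spec X Y (LX : loop_object X) (LY : loop_object Y)
    (f : hohom X Y 0) (f' : hohom (loop_ob LX) (loop_ob LY) 0) : Prop :=
  exists (f0 : closed_hom X Y 0)
         (f0' : closed_hom (loop_ob LX) (loop_ob LY) 0)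
         (t : dg_hom A (loop_ob LX) Y (-2)),
    [/\ cls f0 = f, cls f0' = f'
      & cdiff _ (erefl : -1 = -2 + 1 :> int) t =
        dg_comp (erefl : -1 = -1 + 0 :> int) (val (loop_hom LY)) (val f0')
        - dg_comp (erefl : -1 = 0 + -1 :> int) (val f0) (val (loop_hom LX))].

Lemma loop_map_specE X Y (LX : loop_object X) (LY : loop_object Y)
    (f : hohom X Y 0) (f' : hohom (loop_ob LX) (loop_ob LY) 0) :
  loop_map_spec f f' <->
  hocomp (erefl : -1 = -1 + 0 :> int) (cls (loop_hom LY)) f' =
  hocomp (erefl : -1 = 0 + -1 :> int) f (cls (loop_hom LX)).
Proof.
split=> [[f0 [f0' [t [<- <- tE]]]]|].
  rewrite !hocompE; apply/clsP.
  by exists (-2), (erefl : -1 = -2 + 1 :> int), t; rewrite tE.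
rewrite -(cls_repr f) -(cls_repr f') !hocompE => /clsP[j [e [t tE]]].
have jE : j = -2 by apply: (addIr 1); rewrite -e.
subst j.
exists (repr f), (repr f'), t; split=> //; rewrite [RHS]tE.
by rewrite (eq_irrelevance e (erefl : -1 = -2 + 1 :> int)).
Qed.

Lemma loop_map_exists_unique X Y (LX : loop_object X) (LY : loop_object Y)
    (f : hohom X Y 0) :
  exists! f' : hohom (loop_ob LX) (loop_ob LY) 0, loop_map_spec f f'.
Proof.
have [s sK Ks] :=
  loop_bij LY (loop_ob LX) (erefl : -1 = -1 + 0 :> int) (lexx 0).
exists (s (hocomp (erefl : -1 = 0 + -1 :> int) f (cls (loop_hom LX)))).
split; first by apply/loop_map_specE; rewrite Ks.
by move=> f' /loop_map_specE <-; rewrite sK.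
Qed.

Definition loop_map X Y (LX : loop_object X) (LY : loop_object Y)
    (f : hohom X Y 0) : hohom (loop_ob LX) (loop_ob LY) 0 :=
  sval (cid (loop_map_exists_unique LX LY f)).

Lemma loop_mapP X Y (LX : loop_object X) (LY : loop_object Y)
    (f : hohom X Y 0) : loop_map_spec f (loop_map LX LY f).
Proof. by rewrite /loop_map; case: cid => f' []. Qed.

Lemma loop_object_exists : finitely_complete ->
  forall X : A, inhabited (loop_object X).
Proof.
case=> [[[Z Z0] _] kerA] X.
have [K [f [h [hP kerP]]]] := kerA Z X 0.
have v0 : val (0 : closed_hom Z X 0) = 0 by rewrite raddf0.
have dh : cdiff (dg_hom A K X) (erefl (-1 + 1)) h = 0.
  by rewrite [LHS]hP v0 dg_comp0l oppr0.
pose hK : closed_hom K X (-1) := mkcycle dh.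
have Wbd (W : A) (i : int) (u : closed_hom W Z i) :
    exists (j : int) (e : i = j + 1) (y : dg_hom A W Z j), val u = cdiff _ e y.
  have id0E : cls (closed_id Z) = cls (0 : closed_hom Z Z 0).
    by rewrite raddf0; have [+ _] := Z0 Z; exact.
  have : cls u = cls (0 : closed_hom W Z i).
    transitivity (hocomp (postcomp_deg i) (cls (closed_id Z)) (cls u)).
      by rewrite hocompE; congr cls; apply: val_inj; rewrite /= dg_comp_id_l.
    rewrite id0E hocompE; congr cls; apply: val_inj.
    rewrite [RHS]raddf0 -(dg_comp0l Z (postcomp_deg i) (val u)) /=.
    by congr dg_comp; rewrite -[LHS]/(val (0 : closed_hom Z Z 0)) raddf0.
  by move=> /clsP[j [e [y yE]]]; exists j, e, y; rewrite -yE [X in _ - X]raddf0 subr0.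
have pc0 (W : A) i (u : dg_hom A W Z i) :
    postcomp_fun (0 : closed_hom Z X 0) u = 0.
  by rewrite /postcomp_fun v0 dg_comp0l.
suff hbij (W : A) (i : int) : i <= 0 ->
    bijective
      (hocomp (kernel_deg i) (cls hK) : hohom W K i -> hohom W X (i - 1)).
  constructor; exists K hK => W i n e i0.
  have nE : n = i - 1 by rewrite e addrC.
  move: e; rewrite nE => e.
  by rewrite (eq_irrelevance e (kernel_deg i)); exact: hbij.
move=> i0; have [s sK Ks] := kerP W i i0.
pose P := fib (postcomp (0 : closed_hom Z X 0) W).
have rP (r : closed_hom W X (i - 1)) :
    cdiff P (erefl (i + 1)) ((0, val r) : P i) = 0.
  by rewrite /P /= /fib_diff /= raddf0 pc0 raddf0 oppr0 sub0r cycleP oppr0.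
exists (fun b => s (cls (mkcycle (rP (repr b))))).
  move=> a; rewrite -(cls_repr a); set u := repr a.
  rewrite hocompE -[RHS]sK; congr s; rewrite cohomology_mapE; apply/clsP.
  set r := repr _.
  have : cls r = cls (closed_comp (kernel_deg i) hK u) by exact: cls_repr.
  move=> /clsP[j' [e' [z zE]]].
  have [j [e [y yE]]] := Wbd W i (closed_comp (postcomp_deg i) f u).
  have j'E : j' = j - 1 by apply: (addIr 1); rewrite -e' e addrK subrK.
  subst j'; exists j, e, ((- y, - z) : P j).
  rewrite /= /fib_diff /= pc0 !raddfN /= raddf0 oppr0 sub0r opprK.
  rewrite (eq_irrelevance (fib_deg2 e) e') -zE -yE.
  by congr (_, _); rewrite /= sub0r.
move=> b; rewrite -[RHS]cls_repr; set r := repr b; set a := s _.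
have : cohomology_map (kernel_map hP W) a = cls (mkcycle (rP r)) by rewrite Ks.
rewrite -(cls_repr a) cohomology_mapE hocompE => /clsP[j [e [y]]].
rewrite /= /fib_diff /= pc0 raddf0 oppr0 sub0r => -[_ yE].
by apply/clsP; exists (j - 1), (fib_deg2 e), (- y.2); rewrite raddfN -yE.
Qed.

(* The loop functor attached to a choice L of a loop object of each object;
   loop_object_exists shows that such choices exist. *)
Definition Omega (L : forall X : A, loop_object X) : endofunctor H0 :=
  @Endofunctor H0 (fun X => loop_ob (L X)) (fun X Y => loop_map (L X) (L Y)).

Definition standard_left_triangle (L : forall X : A, loop_object X)
    (A0 A1 A2 : A) (f2 : closed_hom (loop_ob (L A0)) A2 0)
    (f1 : closed_hom A2 A1 0) (f0 : closed_hom A1 A0 0) : Prop :=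
  exists (hf0 : dg_hom A A2 A0 (-1))
         (hf1 : dg_hom A (loop_ob (L A0)) A1 (-1))
         (eta : dg_hom A (loop_ob (L A0)) A0 (-2)),
    [/\ left_exact f1 f0 hf0,
        cdiff _ (erefl : 0 = -1 + 1 :> int) hf1 =
        - dg_comp (erefl : 0 = 0 + 0 :> int) (val f1) (val f2)
      & cdiff _ (erefl : -1 = -2 + 1 :> int) eta =
        dg_comp (erefl : -1 = 0 + -1 :> int) (val f0) hf1
        - dg_comp (erefl : -1 = -1 + 0 :> int) hf0 (val f2)
        - val (loop_hom (L A0))].

Definition left_triangles (L : forall X : A, loop_object X)
    (T : triangle (Omega L)) : Prop :=
  exists (A0 A1 A2 : A) (f2 : closed_hom (loop_ob (L A0)) A2 0)
         (f1 : closed_hom A2 A1 0) (f0 : closed_hom A1 A0 0),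
    standard_left_triangle f2 f1 f0 /\
    triangle_iso T
      (@Triangle H0 (Omega L) A0 A1 A2 (cls f2) (cls f1) (cls f0)).

End HomotopyCategory.

(* Main.v *)
(* A pair (m, n) with d n = - f m is a 0-cycle of Fib (f o -), and left
   exactness of (f1, f0, h) says that u |-> (f1 u, h u) induces a bijection from
   homotopy classes of maps W -> X to homotopy classes of such pairs.  Under it,
   the connecting map f2 of a standard triangle corresponds to the pair
   (0, - h_A0).  Hence a homotopy commutative square induces a map of kernels,
   compatible with the connecting maps because it sends (0, - h) to
   (0, - a h) ~ (0, - h' Omega a); this gives LT3.  The same bijection makes
   H^0 (W, -) exact on triangles, so that a five lemma holds.  For LT2 and LT4
   one compares the expected triangle with one chosen on a kernel of the same
   map; the comparison of the kernels is an isomorphism by diagram chasing. *)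

Require Import Defs.
From mathcomp Require Import all_boot all_order all_algebra.

Set Implicit Arguments.
Unset Strict Implicit.
Unset Printing Implicit Defensive.

Import Order.TTheory GRing.Theory.
Local Open Scope ring_scope.
Local Open Scope pa_scope.

Local Notation d1 := (cdiff _ (erefl : 0 = -1 + 1 :> int)).
Local Notation d2 := (cdiff _ (erefl : -1 = -2 + 1 :> int)).

(* The two digits are the opposites of the degrees of the factors. *)
Local Notation "g *00 f" := (dg_comp (erefl : 0 = 0 + 0 :> int) g f)
  (at level 40, left associativity).
Local Notation "g *01 f" := (dg_comp (erefl : -1 = 0 + -1 :> int) g f)
  (at level 40, left associativity).
Local Notation "g *10 f" := (dg_comp (erefl : -1 = -1 + 0 :> int) g f)
  (at level 40, left associativity).
Local Notation "g *11 f" := (dg_comp (erefl : -2 = -1 + -1 :> int) g f)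
  (at level 40, left associativity).
Local Notation "g *02 f" := (dg_comp (erefl : -2 = 0 + -2 :> int) g f)
  (at level 40, left associativity).
Local Notation "g *20 f" := (dg_comp (erefl : -2 = -2 + 0 :> int) g f)
  (at level 40, left associativity).

(** * Deciding identities in abelian groups by comparing integer coefficients *)

Inductive zmod_expr :=
  | ZVar of nat | ZZero | ZAdd of zmod_expr & zmod_expr | ZOpp of zmod_expr.

Fixpoint zmod_eval (V : zmodType) (env : seq V) e : V :=
  match e with
  | ZVar i => nth 0 env i
  | ZZero => 0
  | ZAdd e1 e2 => zmod_eval env e1 + zmod_eval env e2
  | ZOpp e1 => - zmod_eval env e1
  end.

Fixpoint zmod_coef e (i : nat) : int :=
  match e with
  | ZVar j => (i == j)%:R
  | ZZero => 0
  | ZAdd e1 e2 => zmod_coef e1 i + zmod_coef e2 i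
  | ZOpp e1 => - zmod_coef e1 i
  end.

Lemma zmod_evalE (V : zmodType) (env : seq V) e :
  zmod_eval env e = \sum_(i < size env) env`_i *~ zmod_coef e i.
Proof.
elim: e => /= [j||e1 -> e2 ->|e ->].
- case: (ltnP j (size env)) => [lt_j|le_j].
    rewrite (bigD1 (Ordinal lt_j)) //= eqxx mulr1z big1 ?addr0 // => i.
    by rewrite -val_eqE /= => /negPf->; rewrite mulr0z.
  (* A variable beyond the environment evaluates to the default [0], and its coefficient at every
     index in range is [0] as well. *)
  rewrite nth_default // big1 // => i _.
  by rewrite (ltn_eqF (leq_trans (ltn_ord i) le_j)) mulr0z.
- by rewrite big1 // => i _; rewrite mulr0z.
- by rewrite -big_split; apply: eq_bigr => i _; rewrite mulrzDr.
- by rewrite -sumrN; apply: eq_bigr => i _; rewrite mulrNz.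
Qed.

Lemma zmod_eval_eq (V : zmodType) (env : seq V) e e' :
  all (fun i => zmod_coef e i == zmod_coef e' i) (iota 0 (size env)) ->
  zmod_eval env e = zmod_eval env e'.
Proof.
move=> /allP ee'; rewrite !zmod_evalE; apply: eq_bigr => i _; congr (_ *~ _).
by apply/eqP/ee'; rewrite mem_iota ltn_ord.
Qed.

(** Atoms are matched by [unify], hence up to conversion, since one morphism can occur in several
    convertible forms. The [match constr:(tt)] runs [unify] while a term is being built and falls
    through to the next branch when it fails. *)
Ltac zmod_index x env :=
  lazymatch env with
  | ?y :: ?env' =>
      match constr:(tt) with
      | _ => let _ := lazymatch goal with _ => unify x y end in constr:(0%N)
      | _ => let i := zmod_index x env' in constr:(i.+1)
      end
  end.
Ltac zmod_atoms env t :=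
  lazymatch t with
  | ?a + ?b => let env1 := zmod_atoms env a in zmod_atoms env1 b
  | - ?a => zmod_atoms env a
  | 0 => env
  | _ => match constr:(tt) with
         | _ => let _ := zmod_index t env in env
         | _ => constr:(t :: env)
         end
  end.
Ltac zmod_reify env t :=
  lazymatch t with
  | ?a + ?b => let ea := zmod_reify env a in
               let eb := zmod_reify env b in constr:(ZAdd ea eb)
  | - ?a => let ea := zmod_reify env a in constr:(ZOpp ea)
  | 0 => constr:(ZZero)
  | _ => let i := zmod_index t env in constr:(ZVar i)
  end.
Ltac zmod :=
  lazymatch goal with |- ?x = ?y =>
    let T := type of x in
    let env := zmod_atoms (@nil T) x in
    let env := zmod_atoms env y in
    let ex := zmod_reify env x in
    let ey := zmod_reify env y in
    exact: (@zmod_eval_eq _ env ex ey isT)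
  end.

(** * Leibniz rule and homotopies in degrees 0, -1 and -2 *)

Section LowDegrees.
Variables (k : comPzRingType) (A : dg_category k).
Implicit Types W X Y Z T : A.

Lemma dg_compDr X Y Z i j n (e : n = i + j) (g : dg_hom A Y Z i)
  (f f' : dg_hom A X Y j) :
  dg_comp e g (f + f') = dg_comp e g f + dg_comp e g f'.
Proof. exact: raddfD. Qed.

Lemma dg_compBr X Y Z i j n (e : n = i + j) (g : dg_hom A Y Z i)
  (f f' : dg_hom A X Y j) :
  dg_comp e g (f - f') = dg_comp e g f - dg_comp e g f'.
Proof. exact: raddfB. Qed.

Lemma dg_compNr X Y Z i j n (e : n = i + j) (g : dg_hom A Y Z i)
  (f : dg_hom A X Y j) : dg_comp e g (- f) = - dg_comp e g f.
Proof. exact: raddfN. Qed.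

Lemma dg_comp0r X Y Z i j n (e : n = i + j) (g : dg_hom A Y Z i) :
  dg_comp e g (0 : dg_hom A X Y j) = 0.
Proof. exact: raddf0. Qed.

Lemma dg_compA000 X Y Z T (h : dg_hom A Z T 0) (g : dg_hom A Y Z 0)
  (f : dg_hom A X Y 0) : h *00 g *00 f = h *00 (g *00 f).
Proof. exact: dg_comp_assoc. Qed.

Lemma dg_compA001 X Y Z T (h : dg_hom A Z T 0) (g : dg_hom A Y Z 0)
  (f : dg_hom A X Y (-1)) : h *00 g *01 f = h *01 (g *01 f).
Proof. exact: dg_comp_assoc. Qed.

Lemma dg_compA010 X Y Z T (h : dg_hom A Z T 0) (g : dg_hom A Y Z (-1))
  (f : dg_hom A X Y 0) : h *01 g *10 f = h *01 (g *10 f).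
Proof. exact: dg_comp_assoc. Qed.

Lemma dg_compA100 X Y Z T (h : dg_hom A Z T (-1)) (g : dg_hom A Y Z 0)
  (f : dg_hom A X Y 0) : h *10 g *10 f = h *10 (g *00 f).
Proof. exact: dg_comp_assoc. Qed.

Definition dg_compA := (dg_compA000, dg_compA001, dg_compA010, dg_compA100).

Lemma d1_01 X Y Z (g : closed_hom Y Z 0) (x : dg_hom A X Y (-1)) :
  d1 (val g *01 x) = val g *00 d1 x.
Proof.
rewrite (dg_leibniz _ _ (erefl : 1 = 0 + 1 :> int) (erefl : 0 = -1 + 1 :> int)
  (erefl : 0 = 1 + -1 :> int) (erefl : 0 = 0 + 0 :> int)).
by rewrite cycleP dg_comp0l add0r expr0 scale1r.
Qed.

Lemma d2_02 X Y Z (g : closed_hom Y Z 0) (x : dg_hom A X Y (-2)) :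
  d2 (val g *02 x) = val g *01 d2 x.
Proof.
rewrite (dg_leibniz _ _ (erefl : 1 = 0 + 1 :> int) (erefl : -1 = -2 + 1 :> int)
  (erefl : -1 = 1 + -2 :> int) (erefl : -1 = 0 + -1 :> int)).
by rewrite cycleP dg_comp0l add0r expr0 scale1r.
Qed.

Lemma d1_10 X Y Z (x : dg_hom A Y Z (-1)) (f : closed_hom X Y 0) :
  d1 (x *10 val f) = d1 x *00 val f.
Proof.
rewrite (dg_leibniz _ _ (erefl : 0 = -1 + 1 :> int) (erefl : 1 = 0 + 1 :> int)
  (erefl : 0 = 0 + 0 :> int) (erefl : 0 = -1 + 1 :> int)).
by rewrite cycleP dg_comp0r scaler0 addr0.
Qed.

Lemma d2_20 X Y Z (x : dg_hom A Y Z (-2)) (f : closed_hom X Y 0) :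
  d2 (x *20 val f) = d2 x *10 val f.
Proof.
rewrite (dg_leibniz _ _ (erefl : -1 = -2 + 1 :> int) (erefl : 1 = 0 + 1 :> int)
  (erefl : -1 = -1 + 0 :> int) (erefl : -1 = -2 + 1 :> int)).
by rewrite cycleP dg_comp0r scaler0 addr0.
Qed.

Lemma d2_11 X Y Z (x : dg_hom A Y Z (-1)) (y : dg_hom A X Y (-1)) :
  d2 (x *11 y) = d1 x *01 y - x *10 d1 y.
Proof.
rewrite (dg_leibniz _ _ (erefl : 0 = -1 + 1 :> int) (erefl : 0 = -1 + 1 :> int)
  (erefl : -1 = 0 + -1 :> int) (erefl : -1 = -1 + 0 :> int)).
by rewrite expr1 scaleN1r.
Qed.

Lemma d1_closed X Y (x : closed_hom X Y (-1)) : d1 (val x : dg_hom A X Y (-1)) = 0.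
Proof. exact: cycleP. Qed.

Lemma cls0P X Y (f g : closed_hom X Y 0) :
  (cls f : hohom X Y 0) = cls g <->
  exists c : dg_hom A X Y (-1), val f - val g = d1 c.
Proof.
rewrite clsP; split=> [[j [e [y yE]]]|[c cE]]; last by exists (-1), erefl, c.
have jE : j = -1 by apply: (addIr 1); rewrite -e.
by subst j; exists y; rewrite yE (eq_irrelevance e erefl).
Qed.

Lemma cls1P X Y (f g : closed_hom X Y (-1)) :
  (cls f : hohom X Y (-1)) = cls g <->
  exists c : dg_hom A X Y (-2), val f - val g = d2 c.
Proof.
rewrite clsP; split=> [[j [e [y yE]]]|[c cE]]; last by exists (-2), erefl, c.
have jE : j = -2 by apply: (addIr 1); rewrite -e.
by subst j; exists y; rewrite yE (eq_irrelevance e erefl).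
Qed.

(* Equality of the classes of (m, n) and (m', n') in H^0 (Fib (g o -)). *)
Definition fib_homotopic W Y Z (g : dg_hom A Y Z 0)
    (m : dg_hom A W Y 0) (n : dg_hom A W Z (-1))
    (m' : dg_hom A W Y 0) (n' : dg_hom A W Z (-1)) : Prop :=
  exists (a : dg_hom A W Y (-1)) (b : dg_hom A W Z (-2)),
    m - m' = d1 a /\ n - n' = - (g *01 a) - d2 b.

Lemma cdiff_irr (C : complex k) i j (e e' : j = i + 1) (x : C i) :
  cdiff C e x = cdiff C e' x.
Proof. by rewrite (eq_irrelevance e e'). Qed.

(** The degrees [0 - 1] and [1 - 1] of the second components compute to numerals, so the type
    ascription can name these directly and the transport in the fiber differential disappears. *)
Lemma fib_cdiff_0 W Y Z (g : closed_hom Y Z 0) (m : dg_hom A W Y 0)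
  (n : dg_hom A W Z (-1)) (e : 1 = 0 + 1 :> int) :
  cdiff (fib (postcomp g W)) e (m, n) =
  (cdiff _ e m, - (val g *00 m) - d1 n) :> dg_hom A W Y 1 * dg_hom A W Z 0.
Proof.
rewrite /= /fib_diff /=; congr (_, - _ - _); last exact: cdiff_irr.
transitivity (val g *00 m); last by [].
exact: (ctransport_comp (n := 0) (n' := 0)).
Qed.

Lemma fib_cdiff_1 W Y Z (g : closed_hom Y Z 0) (m : dg_hom A W Y (-1))
  (n : dg_hom A W Z (-2)) (e : 0 = -1 + 1 :> int) :
  cdiff (fib (postcomp g W)) e (m, n) =
  (d1 m, - (val g *01 m) - d2 n) :> dg_hom A W Y 0 * dg_hom A W Z (-1).
Proof.
rewrite /= /fib_diff /=; congr (_, - _ - _).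
- exact: cdiff_irr.
- exact: (ctransport_comp (n := -1) (n' := -1)).
- exact: cdiff_irr.
Qed.

Lemma fib_clsP W Y Z (g : closed_hom Y Z 0)
  (p q : Defs.cycle (fib (postcomp g W)) 0)
  (m m' : dg_hom A W Y 0) (n n' : dg_hom A W Z (-1)) :
  val p = (m, n) -> val q = (m', n') ->
  cls p = cls q <-> fib_homotopic (val g) m n m' n'.
Proof.
move=> pE qE; rewrite clsP pE qE; split=> [[j [e [y yE]]]|[a [b [aE bE]]]].
  have jE : j = -1 by apply: (addIr 1); rewrite -e.
  subst j; case: y yE => a b; rewrite (fib_cdiff_1 g a b e) => -[aE bE].
  by exists a, b.
exists (-1), (erefl : 0 = -1 + 1 :> int), (a, b).
by rewrite fib_cdiff_1 -aE -bE.
Qed.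

(** * The universal property of a homotopy kernel, in terms of pairs *)

Section Kernel.
Variables (X Y Z : A) (f : closed_hom X Y 0) (g : closed_hom Y Z 0).
Variables (h : dg_hom A X Z (-1)) (fgh : left_exact f g h).
Variable W : A.

Lemma left_exact_d1 : d1 h = - (val g *00 val f).
Proof. by case: fgh. Qed.

Lemma kernel_map_0 (hP : homotopy_complex f g h) (u : dg_hom A W X 0) :
  kernel_map hP W 0 u =
  (val f *00 u, h *10 u) :> dg_hom A W Y 0 * dg_hom A W Z (-1).
Proof. by congr (_, _); exact: dg_comp_eq. Qed.

Lemma kernel_map_1 (hP : homotopy_complex f g h) (u : dg_hom A W X (-1)) :
  kernel_map hP W (-1) u =
  (val f *01 u, h *11 u) :> dg_hom A W Y (-1) * dg_hom A W Z (-2).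
Proof. by congr (_, _); exact: dg_comp_eq. Qed.

(** The hypothesis makes [(m, n)] a [0]-cycle of the fiber, so surjectivity of the comparison map on
    [H^0] provides [u]. *)
Lemma left_exact_lift (m : closed_hom W Y 0) (n : dg_hom A W Z (-1)) :
  d1 n = - (val g *00 val m) ->
  exists u : closed_hom W X 0,
    fib_homotopic (val g) (val f *00 val u) (h *10 val u) (val m) n.
Proof.
case: fgh => hP kerP dn.
have mn_cycle : cdiff (fib (postcomp g W)) (erefl (0 + 1)) (val m, n) = 0.
  by rewrite [LHS]fib_cdiff_0 dn opprK addNr [cdiff _ _ _]cycleP.
have [s _ sK] := kerP W 0 (lexx 0).
pose c := cls (mkcycle mn_cycle); exists (repr (s c)).
have := sK c; rewrite -{1}(cls_repr (s c)) cohomology_mapE.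
by move=> /fib_clsP; apply=> //; exact: kernel_map_0.
Qed.

(** Injectivity of the comparison map on [H^0]. Equalities of maps into a kernel are proved below by
    comparing pairs through this lemma. *)
Lemma left_exact_inj (u v : closed_hom W X 0) :
  fib_homotopic (val g) (val f *00 val u) (h *10 val u)
    (val f *00 val v) (h *10 val v) ->
  (cls u : hohom W X 0) = cls v.
Proof.
case: fgh => hP kerP uv; have [s sK _] := kerP W 0 (lexx 0).
rewrite -[cls u]sK -[cls v]sK !cohomology_mapE; congr s.
by apply/fib_clsP; [exact: kernel_map_0.. | ].
Qed.

(* Injectivity in degree 0, with the null homotopy adjusted by surjectivity
   in degree -1. *)
Lemma left_exact_null (u : closed_hom W X 0) (a : dg_hom A W Y (-1))
    (b : dg_hom A W Z (-2)) :
  val f *00 val u = d1 a -> h *10 val u = - (val g *01 a) - d2 b ->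
  exists (c : dg_hom A W X (-1)) (a' : dg_hom A W Y (-2)),
    d1 c = val u /\ val f *01 c = a + d2 a'.
Proof.
move=> fu hu.
have /cls0P[c0] : (cls u : hohom W X 0) = cls (0 : closed_hom W X 0).
  apply: left_exact_inj; exists a, b.
  by rewrite [val 0]raddf0 !dg_comp0r !subr0.
rewrite [val 0]raddf0 subr0 => c0E.
case: fgh => hP kerP.
(* The defect [(f c0 - a, h c0 - b)] is a cycle of degree -1 in the fiber. A cycle [c1] mapping to
   its class can be subtracted from [c0] without changing [d c0], and this turns [f c0] into [a] up
   to a boundary. *)
have fE : d1 (val f *01 c0 - a) = 0.
  rewrite raddfB /= d1_01 -c0E fu; zmod.
have hE : - (val g *01 (val f *01 c0 - a)) - d2 (h *11 c0 - b) = 0.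
  rewrite dg_compBr [d2 (_ - _)]raddfB /= d2_11 -c0E hu left_exact_d1.
  rewrite dg_compNl dg_compA001; zmod.
have cyc : cdiff (fib (postcomp g W)) (erefl (-1 + 1))
    (val f *01 c0 - a, h *11 c0 - b) = 0.
  by rewrite [LHS]fib_cdiff_1 fE hE.
have [s _ sK] := kerP W (-1) isT.
pose c := cls (mkcycle cyc); pose c1 := repr (s c).
have := sK c; rewrite -(cls_repr (s c)) -/c1 cohomology_mapE.
move=> /clsP[j [e [y yE]]].
have jE : j = -2 by apply: (addIr 1); rewrite -e.
subst j; exists (c0 - val c1), (- y.1); split.
  by rewrite raddfB /= d1_closed subr0.
have : kernel_map hP W (-1) (val c1) - (val f *01 c0 - a, h *11 c0 - b) =
  cdiff (fib (postcomp g W)) e y := yE.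
rewrite kernel_map_1 => -[yE1 _].
rewrite raddfN /= (cdiff_irr _ e) -yE1 dg_compBr; zmod.
Qed.

End Kernel.

(** * Operations on homotopy classes of pairs *)

Lemma fib_homotopic_sym W Y Z (g : dg_hom A Y Z 0)
    (m m' : dg_hom A W Y 0) (n n' : dg_hom A W Z (-1)) :
  fib_homotopic g m n m' n' -> fib_homotopic g m' n' m n.
Proof.
case=> a [b [aE bE]]; exists (- a), (- b).
split; first by rewrite -opprB aE raddfN.
rewrite -opprB bE dg_compNr [d2 (- _)]raddfN /=; zmod.
Qed.

Lemma fib_homotopic_trans W Y Z (g : dg_hom A Y Z 0)
    (m m' m'' : dg_hom A W Y 0) (n n' n'' : dg_hom A W Z (-1)) :
  fib_homotopic g m n m' n' -> fib_homotopic g m' n' m'' n'' ->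
  fib_homotopic g m n m'' n''.
Proof.
case=> a [b [aE bE]] [a' [b' [aE' bE']]]; exists (a + a'), (b + b'); split.
  rewrite raddfD /= -aE -aE'; zmod.
rewrite [d2 (_ + _)]raddfD /= dg_compDr -(subrKA n') bE bE'; zmod.
Qed.

Lemma fib_homotopic_opp W Y Z (g : dg_hom A Y Z 0)
    (m m' : dg_hom A W Y 0) (n n' : dg_hom A W Z (-1)) :
  fib_homotopic g m n m' n' -> fib_homotopic g (- m) (- n) (- m') (- n').
Proof.
case=> a [b [aE bE]]; exists (- a), (- b).
split; first by rewrite -opprD aE raddfN.
rewrite -opprD bE dg_compNr [d2 (- _)]raddfN /=; zmod.
Qed.

Lemma fib_homotopic_restrict V W Y Z (g : closed_hom Y Z 0) (v : closed_hom V W 0)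
    (m m' : dg_hom A W Y 0) (n n' : dg_hom A W Z (-1)) :
  fib_homotopic (val g) m n m' n' ->
  fib_homotopic (val g) (m *00 val v) (n *10 val v) (m' *00 val v) (n' *10 val v).
Proof.
case=> a [b [aE bE]]; exists (a *10 val v), (b *20 val v).
by rewrite d1_10 d2_20 -!dg_compBl aE bE dg_compBl dg_compNl dg_compA010.
Qed.

(** A square commuting up to the homotopy [s] induces the chain map [(m, n) |-> (b m, a n - s m)] of
    fibers, and a chain map preserves homology. The same formula in degree -1 carries the homotopy
    [(x, y)] along. *)
Lemma fib_homotopic_push W Y Z Y' Z' (g : closed_hom Y Z 0)
    (g' : closed_hom Y' Z' 0) (b : closed_hom Y Y' 0) (a : closed_hom Z Z' 0)
    (s : dg_hom A Y Z' (-1)) (m m' : dg_hom A W Y 0) (n n' : dg_hom A W Z (-1)) :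
  d1 s = val g' *00 val b - val a *00 val g ->
  fib_homotopic (val g) m n m' n' ->
  fib_homotopic (val g') (val b *00 m) (val a *01 n - s *10 m)
    (val b *00 m') (val a *01 n' - s *10 m').
Proof.
move=> sE [x [y [xE yE]]]; exists (val b *01 x), (val a *02 y - s *11 x).
split; first by rewrite d1_01 -xE dg_compBr.
have -> : forall p q r t : dg_hom A W Z' (-1), p - q - (r - t) = p - r - (q - t).
  move=> p q r t; zmod.
rewrite [d2 (_ - _)]raddfB /= d2_02 d2_11 sE -!dg_compBr xE yE dg_compBr dg_compNr.
rewrite dg_compBl !dg_compA001; zmod.
Qed.

(** This lemma and the next express the chain maps [Fib (f g) -> Fib f] and [Fib g -> Fib (f g)],
    from which the octahedron obtains its maps [u] and [u']. *)
Lemma fib_homotopic_push_source W X Y Z (f : dg_hom A Y Z 0) (g : closed_hom X Y 0)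
    (m m' : dg_hom A W X 0) (n n' : dg_hom A W Z (-1)) :
  fib_homotopic (f *00 val g) m n m' n' ->
  fib_homotopic f (val g *00 m) n (val g *00 m') n'.
Proof.
case=> a [b [aE bE]]; exists (val g *01 a), b.
by rewrite d1_01 -dg_compBr aE bE dg_compA001.
Qed.

Lemma fib_homotopic_push_target W X Y Z (f : closed_hom Y Z 0) (g : dg_hom A X Y 0)
    (m m' : dg_hom A W X 0) (n n' : dg_hom A W Y (-1)) :
  fib_homotopic g m n m' n' ->
  fib_homotopic (val f *00 g) m (val f *01 n) m' (val f *01 n').
Proof.
case=> a [b [aE bE]]; exists a, (val f *02 b).
by rewrite d2_02 -dg_compBr aE bE dg_compBr dg_compNr dg_compA001.
Qed.

(** * Universal property of loop objects and the loop functor on representatives *)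

Section Loops.
Variables (X Y : A) (LX : loop_object X) (LY : loop_object Y).

Lemma loop_lift W (r : dg_hom A W X (-1)) : d1 r = 0 ->
  exists (x : closed_hom W (loop_ob LX) 0) (b : dg_hom A W X (-2)),
    val (loop_hom LX) *10 val x - r = d2 b.
Proof.
move=> dr; pose r' : closed_hom W X (-1) := @mkcycle k (dg_hom A W X) (-1) r dr.
have [s _ sK] := loop_bij LX W (erefl : -1 = -1 + 0 :> int) (lexx 0).
exists (repr (s (cls r'))); have := sK (cls r').
by rewrite -{1}(cls_repr (s (cls r'))) hocompE => /cls1P.
Qed.

Lemma loop_inj W (x y : closed_hom W (loop_ob LX) 0) (b : dg_hom A W X (-2)) :
  val (loop_hom LX) *10 val x - val (loop_hom LX) *10 val y = d2 b ->
  (cls x : hohom W _ 0) = cls y.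
Proof.
have [s sK _] := loop_bij LX W (erefl : -1 = -1 + 0 :> int) (lexx 0).
move=> xyE; rewrite -[cls x]sK -[cls y]sK !hocompE; congr s.
by apply/cls1P; exists b.
Qed.

Lemma loop_map_repr (f : closed_hom X Y 0) :
  exists (f' : closed_hom (loop_ob LX) (loop_ob LY) 0)
         (t : dg_hom A (loop_ob LX) Y (-2)),
    cls f' = loop_map LX LY (cls f) /\
    val (loop_hom LY) *10 val f' - val f *01 val (loop_hom LX) = d2 t.
Proof.
have /loop_map_specE := loop_mapP LX LY (cls f).
rewrite -[loop_map _ _ _]cls_repr !hocompE => /cls1P[t tE].
by exists (repr (loop_map LX LY (cls f))), t; rewrite cls_repr.
Qed.

Lemma loop_mapE (f : closed_hom X Y 0)
    (f' : closed_hom (loop_ob LX) (loop_ob LY) 0)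
    (t : dg_hom A (loop_ob LX) Y (-2)) :
  val (loop_hom LY) *10 val f' - val f *01 val (loop_hom LX) = d2 t ->
  loop_map LX LY (cls f) = cls f'.
Proof.
move=> tE; have [g [gU gE]] := loop_map_exists_unique LX LY (cls f).
rewrite -[LHS]gE; last exact: loop_mapP.
by rewrite -[RHS]gE //; exists f, f', t; rewrite tE.
Qed.

End Loops.

Lemma H0_compE X Y Z (g : closed_hom Y Z 0) (f : closed_hom X Y 0) :
  @pa_comp (H0 A) X Y Z (cls g) (cls f) =
  cls (closed_comp (erefl : 0 = 0 + 0 :> int) g f).
Proof. exact: hocompE. Qed.

End LowDegrees.

(** * Preadditive categories, isomorphisms of triangles and diagram chases *)

Section Preadditive.
Variable C : preadditive.
Implicit Types W X Y Z : C.

Lemma pa_comp0l X Y Z (f : pa_hom X Y) : (0 : pa_hom Y Z) \c f = 0.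
Proof. by apply: (addrI (0 \c f)); rewrite -pa_compDl !addr0. Qed.

Lemma pa_comp0r X Y Z (g : pa_hom Y Z) : g \c (0 : pa_hom X Y) = 0.
Proof. by apply: (addrI (g \c 0)); rewrite -pa_compDr !addr0. Qed.

Lemma pa_compNl X Y Z (g : pa_hom Y Z) (f : pa_hom X Y) : (- g) \c f = - (g \c f).
Proof. by apply/eqP; rewrite -addr_eq0 -pa_compDl addNr pa_comp0l. Qed.

Lemma pa_compNr X Y Z (g : pa_hom Y Z) (f : pa_hom X Y) : g \c (- f) = - (g \c f).
Proof. by apply/eqP; rewrite -addr_eq0 -pa_compDr addNr pa_comp0r. Qed.

Lemma pa_compBr X Y Z (g : pa_hom Y Z) (f f' : pa_hom X Y) :
  g \c (f - f') = g \c f - g \c f'.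
Proof. by rewrite pa_compDr pa_compNr. Qed.

Lemma pa_iso_id X : pa_iso (pa_id X).
Proof. by exists (pa_id X); rewrite pa_comp_id_l. Qed.

Lemma pa_iso_comp X Y Z (g : pa_hom Y Z) (f : pa_hom X Y) :
  pa_iso g -> pa_iso f -> pa_iso (g \c f).
Proof.
move=> [g' [gK Kg]] [f' [fK Kf]]; exists (f' \c g'); split.
  by rewrite pa_comp_assoc -(pa_comp_assoc g') gK pa_comp_id_l.
by rewrite pa_comp_assoc -(pa_comp_assoc f) Kf pa_comp_id_l.
Qed.

(** Lifting [pa_id Y] gives a right inverse [g]. Since [f] kills [g f - 1], injectivity makes [g] a
    left inverse too. *)
Lemma pa_iso_yoneda X Y (f : pa_hom X Y) :
  (forall W (x : pa_hom W X), f \c x = 0 -> x = 0) ->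
  (forall W (y : pa_hom W Y), exists x, f \c x = y) -> pa_iso f.
Proof.
move=> inj surj; have [g fg] := surj Y (pa_id Y); exists g; split=> //.
apply/eqP; rewrite -subr_eq0; apply/eqP/inj.
by rewrite pa_compBr -pa_comp_assoc fg pa_comp_id_l pa_comp_id_r subrr.
Qed.

Variables (Om : endofunctor C) (Om_additive : additive_functor Om).

Let Om_id X : fmap Om (pa_id X) = pa_id (Om X).
Proof. by case: Om_additive. Qed.

Let Om_comp X Y Z (g : pa_hom Y Z) (f : pa_hom X Y) :
  fmap Om (g \c f) = fmap Om g \c fmap Om f.
Proof. by case: Om_additive. Qed.

Lemma functor0 X Y : fmap Om (0 : pa_hom X Y) = 0.
Proof.
case: Om_additive => _ _ OmD.
by apply: (addrI (fmap Om (0 : pa_hom X Y))); rewrite -OmD !addr0.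
Qed.

Lemma triangle_morphism_inv (S T : triangle Om)
  (c : pa_hom (tri_C S) (tri_C T)) (b : pa_hom (tri_B S) (tri_B T))
  (a : pa_hom (tri_A S) (tri_A T)) (c' : pa_hom (tri_C T) (tri_C S))
  (b' : pa_hom (tri_B T) (tri_B S)) (a' : pa_hom (tri_A T) (tri_A S)) :
  triangle_morphism c b a ->
  c' \c c = pa_id _ -> c \c c' = pa_id _ -> b' \c b = pa_id _ ->
  b \c b' = pa_id _ -> a' \c a = pa_id _ -> a \c a' = pa_id _ ->
  triangle_morphism c' b' a'.
Proof.
case=> ch bg af cK Kc bK Kb aK Ka; split.
- have OaK : fmap Om a \c fmap Om a' = pa_id _ by rewrite -Om_comp Ka Om_id.
  rewrite -[tri_h T]pa_comp_id_r -OaK -(pa_comp_assoc (tri_h T)) -ch.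
  by rewrite -!pa_comp_assoc cK pa_comp_id_l.
- by rewrite -[tri_g T]pa_comp_id_r -Kc -(pa_comp_assoc (tri_g T)) -bg
             -!pa_comp_assoc bK pa_comp_id_l.
- by rewrite -[tri_f T]pa_comp_id_r -Kb -(pa_comp_assoc (tri_f T)) -af
             -!pa_comp_assoc aK pa_comp_id_l.
Qed.

Lemma triangle_iso_sym (S T : triangle Om) : triangle_iso S T -> triangle_iso T S.
Proof.
case=> c [b [a [m [c' [cK Kc]] [b' [bK Kb]] [a' [aK Ka]]]]].
exists c', b', a'; split; [|by exists c|by exists b|by exists a].
exact: triangle_morphism_inv m cK Kc bK Kb aK Ka.
Qed.

Lemma triangle_morphism_comp (S T U : triangle Om)
  (c : pa_hom (tri_C S) (tri_C T)) (b : pa_hom (tri_B S) (tri_B T))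
  (a : pa_hom (tri_A S) (tri_A T)) (c' : pa_hom (tri_C T) (tri_C U))
  (b' : pa_hom (tri_B T) (tri_B U)) (a' : pa_hom (tri_A T) (tri_A U)) :
  triangle_morphism c' b' a' -> triangle_morphism c b a ->
  triangle_morphism (c' \c c) (b' \c b) (a' \c a).
Proof.
case=> ch' bg' af' [ch bg af]; split.
- by rewrite pa_comp_assoc ch -pa_comp_assoc ch' Om_comp pa_comp_assoc.
- by rewrite pa_comp_assoc bg -pa_comp_assoc bg' pa_comp_assoc.
- by rewrite pa_comp_assoc af -pa_comp_assoc af' pa_comp_assoc.
Qed.

Lemma triangle_iso_trans (S T U : triangle Om) :
  triangle_iso S T -> triangle_iso T U -> triangle_iso S U.
Proof.
case=> c [b [a [m ci bi ai]]] [c' [b' [a' [m' ci' bi' ai']]]].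
exists (c' \c c), (b' \c b), (a' \c a).
by split; [exact: triangle_morphism_comp | exact: pa_iso_comp..].
Qed.

(** Exactness of [Hom(W, -)] on [Om B -> Om A -> C -> B -> A], with morphisms from [W] playing the
    role of elements in the chases. The field [exact_at_A] concerns the object [Om A]. *)
Record exact_triangle (T : triangle Om) : Prop := ExactTriangle {
  exact_fg : tri_f T \c tri_g T = 0;
  exact_gh : tri_g T \c tri_h T = 0;
  exact_hf : tri_h T \c fmap Om (tri_f T) = 0;
  exact_at_B : forall W (y : pa_hom W (tri_B T)),
    tri_f T \c y = 0 -> exists z, tri_g T \c z = y;
  exact_at_C : forall W (z : pa_hom W (tri_C T)),
    tri_g T \c z = 0 -> exists x, tri_h T \c x = z;
  exact_at_A : forall W (x : pa_hom W (Om (tri_A T))),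
    tri_h T \c x = 0 -> exists y, fmap Om (tri_f T) \c y = x
}.

(** Only the third object varies, because a triangle of the class will be compared with a standard
    one over the same [f]. *)
Lemma exact_triangle_iso (B A D D' : C) (f : pa_hom B A)
    (g : pa_hom D B) (h : pa_hom (Om A) D) (g' : pa_hom D' B)
    (h' : pa_hom (Om A) D') (c : pa_hom D D') :
  pa_iso c -> c \c h = h' -> g' \c c = g ->
  exact_triangle (Triangle h' g' f) -> exact_triangle (Triangle h g f).
Proof.
move=> [c' [cK Kc]] ch gc [/= fg gh hf eB eC eA].
have hE : h = c' \c h' by rewrite -ch -pa_comp_assoc cK pa_comp_id_l.
have c'_inj W (x : pa_hom W D') : c' \c x = 0 -> x = 0.
  by move=> x0; rewrite -[x]pa_comp_id_l -Kc pa_comp_assoc x0 pa_comp0r.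
split=> /= [|||W y|W z|W x].
- by rewrite -gc -pa_comp_assoc fg pa_comp0l.
- by rewrite -gc pa_comp_assoc ch gh.
- by rewrite hE pa_comp_assoc hf pa_comp0r.
- move=> /eB[z <-]; exists (c' \c z).
  by rewrite -gc pa_comp_assoc -(pa_comp_assoc c) Kc pa_comp_id_l.
- rewrite -gc pa_comp_assoc => /eC[x xE]; exists x.
  by rewrite hE pa_comp_assoc xE -pa_comp_assoc cK pa_comp_id_l.
- by rewrite hE pa_comp_assoc => /c'_inj/eA.
Qed.

(** The five lemma. The square on [Om B -> Om A] is the image under [Om] of the square formed by the
    inverses of [a] and [b]. *)
Lemma exact_five (S T : triangle Om) (c : pa_hom (tri_C S) (tri_C T))
    (b : pa_hom (tri_B S) (tri_B T)) (a : pa_hom (tri_A S) (tri_A T)) :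
  exact_triangle S -> exact_triangle T -> triangle_morphism c b a ->
  pa_iso b -> pa_iso a -> pa_iso c.
Proof.
move=> eS eT [ch bg af] [b' [bK Kb]] [a' [aK Ka]].
have OaK : fmap Om a' \c fmap Om a = pa_id _ by rewrite -Om_comp aK Om_id.
have OKa : fmap Om a \c fmap Om a' = pa_id _ by rewrite -Om_comp Ka Om_id.
have af' : a' \c tri_f T = tri_f S \c b'.
  by rewrite -[tri_f T]pa_comp_id_r -Kb -(pa_comp_assoc (tri_f T)) -af
             -!pa_comp_assoc aK pa_comp_id_l.
apply: pa_iso_yoneda => W.
  move=> x x0.
  have : tri_g S \c x = 0.
    rewrite -[tri_g S]pa_comp_id_l -bK (pa_comp_assoc b') bg !pa_comp_assoc x0.
    by rewrite !pa_comp0r.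
  move=> /(exact_at_C eS)[y yE].
  have : tri_h T \c (fmap Om a \c y) = 0.
    by rewrite -pa_comp_assoc -ch pa_comp_assoc yE.
  move=> /(exact_at_A eT)[z zE].
  rewrite -yE -[y]pa_comp_id_l -OaK pa_comp_assoc -zE -(pa_comp_assoc (fmap Om a')).
  by rewrite -Om_comp af' Om_comp -!pa_comp_assoc (exact_hf eS) !pa_comp0l.
move=> w.
have : tri_f S \c (b' \c (tri_g T \c w)) = 0.
  rewrite -pa_comp_assoc -af' pa_comp_assoc -(pa_comp_assoc (tri_f T)).
  by rewrite (exact_fg eT) pa_comp0l pa_comp0r.
move=> /(exact_at_B eS)[z zE].
have : tri_g T \c (w - c \c z) = 0.
  rewrite pa_compBr -(pa_comp_assoc _ c) -bg pa_comp_assoc zE.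
  by rewrite -pa_comp_assoc Kb pa_comp_id_l subrr.
move=> /(exact_at_C eT)[x xE]; exists (z + (tri_h S \c (fmap Om a' \c x))).
rewrite pa_compDr -(pa_comp_assoc c (tri_h S)) ch pa_comp_assoc.
by rewrite -(pa_comp_assoc (fmap Om a)) OKa pa_comp_id_l xE addrC subrK.
Qed.

(** The first triangle gives no control over the kernel of [fmap Om f], so [exact_five] does not
    apply to its rotation. Instead, a [y] whose image under [fmap Om f] is killed by [t] is killed
    by [k''], hence comes from [fmap Om g], and [f \c g = 0] makes that image vanish. *)
Lemma exact_rotation_iso (A B D K : C) (f : pa_hom B A) (g : pa_hom D B)
    (h : pa_hom (Om A) D) (k' : pa_hom K D) (k'' : pa_hom (Om B) K)
    (t : pa_hom (Om A) K) :
  exact_triangle (Triangle h g f) -> exact_triangle (Triangle k'' k' g) ->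
  k' \c t = h -> t \c - fmap Om f = k'' -> pa_iso t.
Proof.
move=> e e' k't tf; apply: pa_iso_yoneda => W x.
  move=> tx0; have : h \c x = 0 by rewrite -k't pa_comp_assoc tx0 pa_comp0r.
  move=> /(exact_at_A e)[y /= yE].
  have : k'' \c y = 0.
    by rewrite -tf pa_comp_assoc pa_compNl yE pa_compNr tx0 oppr0.
  move=> /(exact_at_A e')[z /= zE].
  by rewrite -yE -zE -pa_comp_assoc -Om_comp (exact_fg e) functor0 pa_comp0l.
have : g \c (k' \c x) = 0 by rewrite -pa_comp_assoc (exact_fg e') pa_comp0l.
move=> /(exact_at_C e)[y /= yE].
have : k' \c (x - t \c y) = 0.
  by rewrite pa_compBr -pa_comp_assoc k't yE subrr.
move=> /(exact_at_C e')[z /= zE]; exists (y + (- fmap Om f) \c z).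
by rewrite pa_compDr -(pa_comp_assoc t) tf zE addrC subrK.
Qed.

(** The three rotated triangles extend exactness to the left: what [Om f], [Om f'] and [Om (f g)]
    kill comes from [Om f'], [Om f''] and [Om v'] respectively. *)
Lemma exact_octahedron_iso (A B X D E F K : C)
    (f'' : pa_hom (Om A) F) (f' : pa_hom F B) (f : pa_hom B A)
    (g'' : pa_hom (Om B) E) (g' : pa_hom E X) (g : pa_hom X B)
    (v'' : pa_hom (Om A) D) (v' : pa_hom D X)
    (k'' : pa_hom (Om F) K) (k' : pa_hom K D)
    (u' : pa_hom E D) (u : pa_hom D F) (p : pa_hom K E) :
  exact_triangle (Triangle (- fmap Om f) f'' f') ->
  exact_triangle (Triangle (- fmap Om f') (- fmap Om f) f'') ->
  exact_triangle (Triangle (- fmap Om (f \c g)) v'' v') ->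
  exact_triangle (Triangle g'' g' g) ->
  exact_triangle (Triangle v'' v' (f \c g)) ->
  exact_triangle (Triangle k'' k' u) ->
  f' \c u = g \c v' -> u \c v'' = f'' -> v' \c u' = g' ->
  u' \c g'' = v'' \c fmap Om f -> u \c u' = 0 ->
  p \c k'' = g'' \c fmap Om f' -> u' \c p = k' -> pa_iso p.
Proof.
move=> rf rrf rv eg ev eu f'u uv'' v'u' u'g'' uu' pk'' u'p.
have OfK W (y : pa_hom W (Om B)) : fmap Om f \c y = 0 -> exists x, fmap Om f' \c x = y.
  by move=> y0; apply: (exact_at_A rf); rewrite /= pa_compNl y0 oppr0.
apply: pa_iso_yoneda => W x.
  (* Injectivity: [x = k'' y], and the chase shows that [y] lies in the image of [Om u], on which
     [k''] vanishes. First [y] is corrected by some [Om u d] to be killed by [Om f']; the rest comes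
     from [Om f'' = Om u Om v'']. *)
  move=> px0; have : k' \c x = 0 by rewrite -u'p pa_comp_assoc px0 pa_comp0r.
  move=> /(exact_at_C eu)[y /= yE].
  have : g'' \c (fmap Om f' \c y) = 0.
    by rewrite -pa_comp_assoc -pk'' pa_comp_assoc yE.
  move=> /(exact_at_A eg)[z /= zE].
  have : (- fmap Om (f \c g)) \c z = 0.
    rewrite pa_compNl Om_comp pa_comp_assoc zE -pa_comp_assoc -Om_comp.
    have := exact_gh rrf => /=; rewrite pa_compNl pa_compNr opprK -Om_comp => ->.
    by rewrite pa_comp0l oppr0.
  move=> /(exact_at_A rv)[d /= dE].
  have : (- fmap Om f') \c (y - fmap Om u \c d) = 0.
    rewrite pa_compNl pa_compBr -zE -dE -!pa_comp_assoc -!Om_comp f'u.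
    by rewrite subrr oppr0.
  move=> /(exact_at_A rrf)[w /= wE].
  rewrite -yE -[y](subrK (fmap Om u \c d)) -wE -uv'' Om_comp pa_comp_assoc.
  by rewrite -pa_compDr -pa_comp_assoc (exact_hf eu) pa_comp0l.
(* Surjectivity: up to the image of [p], the element [x] is killed by [u'], hence is some [g'' b].
   Changing [b] by [Om g c], which [g''] kills, makes it come from [Om f'], and
   [g'' Om f' = p k'']. *)
have : u \c (u' \c x) = 0 by rewrite -pa_comp_assoc uu' pa_comp0l.
move=> /(exact_at_B eu)[z /= zE].
have u'z : u' \c (x - p \c z) = 0 by rewrite pa_compBr -pa_comp_assoc u'p zE subrr.
have : g' \c (x - p \c z) = 0 by rewrite -v'u' pa_comp_assoc u'z pa_comp0r.
move=> /(exact_at_C eg)[b /= bE].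
have : v'' \c (fmap Om f \c b) = 0.
  by rewrite -pa_comp_assoc -u'g'' pa_comp_assoc bE.
move=> /(exact_at_A ev)[c /= cE].
have : fmap Om f \c (b - fmap Om g \c c) = 0.
  by rewrite pa_compBr -pa_comp_assoc -Om_comp cE subrr.
move=> /OfK[y yE]; exists (z + k'' \c y).
rewrite pa_compDr -pa_comp_assoc pk'' pa_comp_assoc yE pa_compBr -pa_comp_assoc.
by rewrite (exact_hf eg) pa_comp0l subr0 bE addrC subrK.
Qed.

End Preadditive.

(** * Standard left triangles: exactness, maps, rotation and octahedron *)

Section Standard.
Variables (k : comPzRingType) (A : dg_category k).
Variable L : forall X : A, loop_object X.
Implicit Types W X Y Z : A.

Let loop X := loop_ob (L X).
Let lhom X : closed_hom (loop X) X (-1) := loop_hom (L X).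

Lemma H0_elim X Y (P : hohom X Y 0 -> Prop) :
  (forall f : closed_hom X Y 0, P (cls f)) -> forall f, P f.
Proof. by move=> Pcls f; rewrite -(cls_repr f). Qed.

(** By the uniqueness in [loop_mapE], each law only requires a homotopy for the expected
    representative. *)
Lemma Omega_additive : additive_functor (Omega L).
Proof.
split=> [X|X Y Z|X Y].
- rewrite [LHS](@loop_mapE _ _ _ _ (L X) (L X) (closed_id X) (closed_id (loop X)) 0) //.
  rewrite raddf0 /= dg_comp_id_r dg_comp_id_l; zmod.
- elim/H0_elim=> g; elim/H0_elim=> f; rewrite H0_compE /=.
  have [f' [t [<- tE]]] := loop_map_repr (L X) (L Y) f.
  have [g' [s [<- sE]]] := loop_map_repr (L Y) (L Z) g.
  (* The two squares are pasted: [h_Z g' f' ~ g h_Y f' ~ g f h_X]. *)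
  rewrite hocompE; apply: (loop_mapE (t := s *20 val f' + val g *02 t)).
  rewrite raddfD /= d2_20 d2_02 -sE -tE dg_compBl dg_compBr.
  rewrite dg_compA100 dg_compA001 dg_compA010; zmod.
elim/H0_elim=> f; elim/H0_elim=> g; rewrite -raddfD /=.
have [f' [t [<- tE]]] := loop_map_repr (L X) (L Y) f.
have [g' [s [<- sE]]] := loop_map_repr (L X) (L Y) g.
rewrite -raddfD; apply: (loop_mapE (t := t + s)).
rewrite [d2 (_ + _)]raddfD /= -tE -sE !raddfD /= dg_compDl; zmod.
Qed.

(** The homotopies of the definition correspond to those of [fib_homotopic] by [a = - hf1] and
    [b = eta]. *)
Lemma standard_left_triangleP X Y Z (f2 : closed_hom (loop Z) X 0)
    (f1 : closed_hom X Y 0) (f0 : closed_hom Y Z 0) :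
  standard_left_triangle f2 f1 f0 <->
  exists h, left_exact f1 f0 h /\
    fib_homotopic (val f0) (val f1 *00 val f2) (h *10 val f2) 0 (- val (lhom Z)).
Proof.
split=> [[h [h1 [eta [ex h1E etaE]]]]|[h [ex [a [b [aE bE]]]]]].
  exists h; split=> //; exists (- h1), eta; split.
    rewrite raddfN /= h1E; zmod.
  rewrite etaE dg_compNr; zmod.
exists h, (- a), b; split=> //; first by (rewrite raddfN /= -aE; zmod).
have -> : h *10 val f2 = - (val f0 *01 a) - d2 b - val (lhom Z).
  rewrite -bE; zmod.
rewrite dg_compNr; zmod.
Qed.

Lemma connecting_exists X Y Z (f1 : closed_hom X Y 0) (f0 : closed_hom Y Z 0) h :
  left_exact f1 f0 h -> exists f2 : closed_hom (loop Z) X 0,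
  fib_homotopic (val f0) (val f1 *00 val f2) (h *10 val f2) 0 (- val (lhom Z)).
Proof.
move=> ex; have v0 : val (0 : closed_hom (loop Z) Y 0) = 0 by rewrite raddf0.
have := left_exact_lift ex (m := 0 : closed_hom (loop Z) Y 0) (n := - val (lhom Z)).
by rewrite v0 dg_comp0r raddfN /= d1_closed; apply.
Qed.

Lemma standard_exists Y Z (f0 : closed_hom Y Z 0) : finitely_complete A ->
  exists X (f2 : closed_hom (loop Z) X 0) (f1 : closed_hom X Y 0),
    standard_left_triangle f2 f1 f0.
Proof.
move=> [_ /(_ Y Z f0)[X [f1 [h ex]]]].
have [f2 f2E] := connecting_exists ex.
by exists X, f2, f1; apply/standard_left_triangleP; exists h.
Qed.

Lemma cls0 X Y : cls (0 : closed_hom X Y 0) = (0 : hohom X Y 0).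
Proof. exact: raddf0. Qed.

Lemma cls_eq0P X Y (f : closed_hom X Y 0) :
  (cls f : hohom X Y 0) = 0 <-> exists c : dg_hom A X Y (-1), val f = d1 c.
Proof.
rewrite -cls0 cls0P.
by split=> -[c cE]; exists c; move: cE; rewrite [val 0]raddf0 subr0.
Qed.

Lemma connecting_restrict V X Y Z (f2 : closed_hom (loop Z) X 0)
    (f1 : closed_hom X Y 0) (f0 : closed_hom Y Z 0) h (x : closed_hom V (loop Z) 0) :
  fib_homotopic (val f0) (val f1 *00 val f2) (h *10 val f2) 0 (- val (lhom Z)) ->
  fib_homotopic (val f0) (val f1 *00 (val f2 *00 val x)) (h *10 (val f2 *00 val x))
    0 (- (val (lhom Z) *10 val x)).
Proof.
move=> /(fib_homotopic_restrict x).
by rewrite dg_compA000 dg_compA100 dg_comp0l dg_compNl.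
Qed.

Lemma standard_exact X Y Z (f2 : closed_hom (loop Z) X 0)
    (f1 : closed_hom X Y 0) (f0 : closed_hom Y Z 0) :
  standard_left_triangle f2 f1 f0 ->
  @exact_triangle (H0 A) (Omega L) (@Triangle (H0 A) (Omega L) Z Y X
    (cls f2) (cls f1) (cls f0)).
Proof.
move=> /standard_left_triangleP[h [ex f2E]].
have dh := left_exact_d1 ex.
have f2xE W (x : closed_hom W (loop Z) 0) := connecting_restrict x f2E.
have [Of [t [OfE tE]]] := loop_map_repr (L Y) (L Z) f0.
split=> /=; rewrite ?hocompE.
- by apply/cls_eq0P; exists (- h); rewrite raddfN /= dh opprK.
- by apply/cls_eq0P; case: f2E => a [b [aE _]]; exists a; rewrite -aE subr0.
- rewrite -OfE hocompE -cls0.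
  apply: (left_exact_inj ex).
  rewrite [val 0]raddf0 !dg_comp0r; apply: fib_homotopic_trans (f2xE _ Of) _.
  (* The pair of [f2 Of] is [(0, - h_Z Of)], and [h_Z Of ~ f0 h_Y]. As [h_Y] is a cycle, it serves
     as a homotopy from [0] to [0] absorbing [f0 h_Y]. *)
  exists (val (lhom Y)), t; rewrite d1_closed; split; first zmod.
  rewrite -tE; zmod.
- move=> W; elim/H0_elim=> y; rewrite hocompE => /cls_eq0P[c cE].
  have [|u [a [b [aE _]]]] := left_exact_lift ex (m := y) (n := - c).
    by rewrite raddfN /= -cE.
  by exists (cls u); rewrite hocompE; apply/cls0P; exists a.
- move=> W; elim/H0_elim=> z; rewrite hocompE => /cls_eq0P[a /= aE].
  (* The null homotopy [a] of [f1 z] replaces the pair of [z] by [(0, h z + f0 a)], whose second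
     entry is a cycle and so equals [h_Z x] up to a boundary. The sign in [- cls x] offsets the one
     in the pair [(0, - h_Z)] of [f2]. *)
  have rE : d1 (h *10 val z + val f0 *01 a) = 0.
    rewrite [d1 (_ + _)]raddfD /= d1_10 d1_01 -aE dh dg_compNl.
    rewrite dg_compA000; zmod.
  have [x [b xE]] := loop_lift (L Z) rE.
  exists (- cls x); rewrite -raddfN hocompE; apply: (left_exact_inj ex).
  apply: fib_homotopic_trans (f2xE _ (- x)) _; apply: fib_homotopic_sym.
  exists a, b; rewrite aE raddfN dg_compNr -xE /=; split; zmod.
move=> W; elim/H0_elim=> x; rewrite hocompE => /cls_eq0P[c /= cE].
(* The pair of [f2 x] is null as well as homotopic to [(0, - h_Z x)]. The resulting [a] goes from
   [0] to [0], so it is a cycle and lifts to [y : W -> Omega Y]; then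
   [h_Z x ~ - f0 a ~ - h_Z Of y]. *)
have [a [b [aE bE]]] : fib_homotopic (val f0) 0 0 0 (- (val (lhom Z) *10 val x)).
  apply: fib_homotopic_trans (f2xE _ x); apply: fib_homotopic_sym.
  exists (val f1 *01 c), (h *11 c); rewrite d1_01 d2_11 cE dh dg_compNl dg_compA001.
  split; zmod.
have rE : d1 a = 0.
  rewrite -aE; zmod.
have [y [s sE]] := loop_lift (L Y) rE.
exists (- cls y); rewrite -raddfN -OfE hocompE.
apply: (loop_inj (b := b - (t *20 val y + val f0 *02 s))).
rewrite [d2 (_ - _)]raddfB /= [d2 (_ + _)]raddfD /= d2_20 d2_02 -sE -tE.
have -> : d2 b = - (val f0 *01 a) - val (lhom Z) *10 val x.
  have := bE; rewrite sub0r opprK => ->; zmod.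
rewrite dg_compBl dg_compBr dg_compA100 dg_compA010 raddfN /= !dg_compNr; zmod.
Qed.
(** The map [c] lifts the image of the pair [(f1, h)] under the map of fibers defined by
    [(b, a, s)]. Its whole pair is recorded, not just the square [f1' c ~ b f1], since the
    octahedron also uses the second entry. *)
Lemma standard_map X Y Z (f2 : closed_hom (loop Z) X 0) (f1 : closed_hom X Y 0)
    (f0 : closed_hom Y Z 0) h X' Y' Z' (f2' : closed_hom (loop Z') X' 0)
    (f1' : closed_hom X' Y' 0) (f0' : closed_hom Y' Z' 0) h'
    (b : closed_hom Y Y' 0) (a : closed_hom Z Z' 0) (s : dg_hom A Y Z' (-1)) :
  left_exact f1 f0 h ->
  fib_homotopic (val f0) (val f1 *00 val f2) (h *10 val f2) 0 (- val (lhom Z)) ->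
  left_exact f1' f0' h' ->
  fib_homotopic (val f0') (val f1' *00 val f2') (h' *10 val f2') 0 (- val (lhom Z')) ->
  d1 s = val f0' *00 val b - val a *00 val f0 ->
  exists c : closed_hom X X' 0,
    fib_homotopic (val f0') (val f1' *00 val c) (h' *10 val c)
      (val b *00 val f1) (val a *01 h - s *10 val f1) /\
    @pa_comp (H0 A) _ _ _ (cls c) (cls f2) =
    @pa_comp (H0 A) _ _ _ (cls f2') (fmap (Omega L) (cls a : @pa_hom (H0 A) Z Z')).
Proof.
move=> ex f2E ex' f2E' sE; have dh := left_exact_d1 ex.
have [|c cE] := left_exact_lift ex' (m := closed_comp (erefl : 0 = 0 + 0 :> int) b f1)
    (n := val a *01 h - s *10 val f1).
  rewrite [d1 (_ - _)]raddfB /= d1_01 d1_10 dh sE dg_compNr dg_compBl !dg_compA000.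
  zmod.
exists c; split=> //.
have [Oa [t [OaE tE]]] := loop_map_repr (L Z) (L Z') a.
rewrite /= -OaE !hocompE; apply: (left_exact_inj ex') => /=.
have := fib_homotopic_restrict f2 cE; rewrite dg_compA000 dg_compA100 => E.
apply: fib_homotopic_trans E _; rewrite /= dg_compBl !dg_compA.
apply: fib_homotopic_trans (fib_homotopic_push sE f2E) _.
apply: fib_homotopic_trans _ (fib_homotopic_sym (connecting_restrict Oa f2E')).
exists 0, (- t); rewrite !dg_comp0r dg_compNr; split.
  rewrite [d1 0]raddf0; zmod.
rewrite [d2 (- _)]raddfN /= -tE; zmod.
Qed.

(* With the kernel K of f1, the null homotopy of f1 o f2 defines
   t : Omega Z -> K; composing it with - Omega f0 gives the connecting map
   of K since f2 o Omega f0 has a null homotopy compatible with it. *)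
Lemma standard_rotation X Y Z (f2 : closed_hom (loop Z) X 0) (f1 : closed_hom X Y 0)
    (f0 : closed_hom Y Z 0) h K (k2 : closed_hom (loop Y) K 0)
    (k1 : closed_hom K X 0) hK :
  left_exact f1 f0 h ->
  fib_homotopic (val f0) (val f1 *00 val f2) (h *10 val f2) 0 (- val (lhom Z)) ->
  left_exact k1 f1 hK ->
  fib_homotopic (val f1) (val k1 *00 val k2) (hK *10 val k2) 0 (- val (lhom Y)) ->
  exists t : hohom (loop Z) K 0,
    @pa_comp (H0 A) _ _ _ (cls k1) t = cls f2 /\
    @pa_comp (H0 A) _ _ _ t (- fmap (Omega L) (cls f0 : @pa_hom (H0 A) Y Z)) = cls k2.
Proof.
move=> ex f2E exK k2E.
have [a [b [aE bE]]] := f2E.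
have [|t tE] := left_exact_lift exK (m := f2) (n := - a).
  rewrite [d1 (- _)]raddfN /= -aE; zmod.
exists (cls t); split.
  by rewrite /= hocompE; apply/cls0P; case: tE => c [_ [cE _]]; exists c.
have [Of [s [OfE sE]]] := loop_map_repr (L Y) (L Z) f0.
rewrite /= -OfE -raddfN hocompE; apply: (left_exact_inj exK).
(* Here [- q] is the difference between the second entries [a Of] and [- h_Y] of the pairs of
   [- t Of] and [k2]. A null homotopy [c] of [f2 Of] with [f1 c ~ - q] therefore identifies these
   two pairs. *)
pose q := - (a *10 val Of) - val (lhom Y).
have [||c [a' [/= dc fc]]] := left_exact_null ex
  (u := closed_comp (erefl : 0 = 0 + 0 :> int) f2 Of)
  (a := - q) (b := s + b *20 val Of).
- rewrite /q [d1 (- _)]raddfN /= [d1 (_ - _)]raddfB /= [d1 (- _)]raddfN /= d1_closed.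
  rewrite d1_10 -aE dg_compBl dg_comp0l dg_compA000; zmod.
- have hf2 : h *10 val f2 = - (val f0 *01 a) - d2 b - val (lhom Z).
    rewrite -bE; zmod.
  rewrite /= -dg_compA100 hf2 !dg_compBl dg_compNl.
  rewrite dg_compA010 [d2 (_ + _)]raddfD /= d2_20 -sE /q dg_compNr dg_compBr dg_compNr.
  zmod.
have E := fib_homotopic_opp (fib_homotopic_restrict Of tE).
move: E; rewrite dg_compA000 dg_compA100 => E.
rewrite /= raddfN /= !dg_compNr; apply: fib_homotopic_trans E _.
apply: fib_homotopic_trans _ (fib_homotopic_sym k2E).
exists (- c), a'; split; first by rewrite [d1 (- _)]raddfN /= dc subr0.
rewrite dg_compNr fc /q dg_compNl; zmod.
Qed.

Local Notation ho0 b a := (hocomp (erefl : 0 = 0 + 0 :> int) b a).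

(** The maps [u] and [u'] lift the pairs [(g v1, hv)] and [(g1, f hg)]. The map [p] is constructed
    in the same lemma because it has to use the homotopy [gam] for [f1 u ~ g v1] that comes with
    [u]: the proof of [u' p = k1] relies on it. *)
Lemma standard_octahedron X Y Z D E F (f : closed_hom Y Z 0) (g : closed_hom X Y 0)
    (f2 : closed_hom (loop Z) F 0) (f1 : closed_hom F Y 0) hf
    (g2 : closed_hom (loop Y) E 0) (g1 : closed_hom E X 0) hg
    (v2 : closed_hom (loop Z) D 0) (v1 : closed_hom D X 0) hv
    (fg := closed_comp (erefl : 0 = 0 + 0 :> int) f g) :
  left_exact f1 f hf ->
  fib_homotopic (val f) (val f1 *00 val f2) (hf *10 val f2) 0 (- val (lhom Z)) ->
  left_exact g1 g hg ->
  fib_homotopic (val g) (val g1 *00 val g2) (hg *10 val g2) 0 (- val (lhom Y)) ->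
  left_exact v1 fg hv ->
  fib_homotopic (val fg) (val v1 *00 val v2) (hv *10 val v2) 0 (- val (lhom Z)) ->
  exists (u : closed_hom D F 0) (u' : hohom E D 0),
    [/\ ho0 (cls f1) (cls u) =
          ho0 (cls g) (cls v1),
        ho0 (cls u) (cls v2) = cls f2,
        ho0 (cls v1) u' = cls g1,
        ho0 u' (cls g2) =
          ho0 (cls v2) (loop_map (L Y) (L Z) (cls f))
      & ho0 (cls u) u' = 0] /\
    forall K (k2 : closed_hom (loop F) K 0) (k1 : closed_hom K D 0) hK,
      left_exact k1 u hK ->
      fib_homotopic (val u) (val k1 *00 val k2) (hK *10 val k2) 0 (- val (lhom F)) ->
      exists p : hohom K E 0,
        ho0 p (cls k2) =
          ho0 (cls g2) (loop_map (L F) (L Y) (cls f1)) /\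
        ho0 u' p = cls k1.
Proof.
move=> exF f2E exE g2E exD v2E.
have dhf := left_exact_d1 exF; have dhg := left_exact_d1 exE.
have dhv := left_exact_d1 exD; rewrite /= dg_compA000 in dhv.
have [//|u uE] :=
  left_exact_lift exF (m := closed_comp (erefl : 0 = 0 + 0 :> int) g v1) (n := hv).
have [|u' u'E] := left_exact_lift exD (m := g1) (n := val f *01 hg).
  by rewrite d1_01 dhg dg_compNr /= dg_compA000.
exists u, (cls u').
have [gam [del [gamE delE]]] := uE.
split; first split.
- by rewrite !hocompE; apply/cls0P; exists gam.
- rewrite hocompE; apply: (left_exact_inj exF) => /=.
  have := fib_homotopic_restrict v2 uE; rewrite /= !dg_compA => H.
  apply: fib_homotopic_trans H _.
  apply: fib_homotopic_trans (fib_homotopic_push_source v2E) _.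
  by rewrite dg_comp0r; exact: fib_homotopic_sym.
- by rewrite hocompE; apply/cls0P; case: u'E => a [b [aE _]]; exists a.
- have [Of [t [<- tE]]] := loop_map_repr (L Y) (L Z) f.
  rewrite !hocompE; apply: (left_exact_inj exD) => /=.
  have := fib_homotopic_restrict g2 u'E; rewrite /= !dg_compA => H.
  apply: fib_homotopic_trans H _.
  have H := fib_homotopic_push_target f g2E.
  apply: fib_homotopic_trans H _.
  apply: fib_homotopic_trans _ (fib_homotopic_sym (connecting_restrict Of v2E)).
  rewrite dg_compNr; exists 0, (- t); rewrite dg_comp0r; split.
    rewrite [d1 0]raddf0; zmod.
  rewrite [d2 (- _)]raddfN /= -tE; zmod.
- rewrite hocompE -cls0; apply: (left_exact_inj exF).
  rewrite [val 0]raddf0 !dg_comp0r /=.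
  have := fib_homotopic_restrict u' uE; rewrite /= !dg_compA => H.
  apply: fib_homotopic_trans H _.
  apply: fib_homotopic_trans (fib_homotopic_push_source u'E) _.
  (* The pair of [u u'] is [(g g1, f hg)], which is the boundary of [(- hg, 0)]. *)
  exists (- hg), 0.
  rewrite [d1 (- _)]raddfN [d2 0]raddf0 /= dhg dg_compNr; split; zmod.
move=> K k2 k1 hK exK k2E.
have gamE' : d1 (- gam) = val g *00 val v1 - val f1 *00 val u.
  rewrite [d1 (- _)]raddfN /= -gamE; zmod.
have [p [pE pk]] := standard_map exK k2E exE g2E gamE'.
exists (cls p); split; first exact: pk.
rewrite hocompE; apply: (left_exact_inj exD) => /=.
have := fib_homotopic_restrict p u'E; rewrite /= !dg_compA => H.
apply: fib_homotopic_trans H _.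
apply: fib_homotopic_trans (fib_homotopic_push_target f pE) _.
(* With [hv = hf u + f gam + d del], the terms in [gam] cancel; the remainder [f f1 hK - hf u k1] is
   [- d (hf hK)]. *)
exists 0, (hf *11 hK + del *20 val k1); split.
  rewrite [d1 0]raddf0; zmod.
have -> : hv *10 val k1 = hf *10 (val u *00 val k1) +
    val f *01 (gam *10 val k1) + d2 del *10 val k1.
  have -> : hv = hf *10 val u + val f *01 gam + d2 del.
    rewrite -[hf *10 _](subrK hv) delE; zmod.
  by rewrite !dg_compDl dg_compA100 dg_compA010.
rewrite [d2 (_ + _)]raddfD /= d2_11 d2_20 dhf (left_exact_d1 exK) dg_comp0r.
rewrite dg_compBr !dg_compNl dg_compNr dg_compA001 dg_compNr; zmod.
Qed.

(** * Triangles isomorphic to standard ones *)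

Local Notation Tri h g f := (@Triangle (H0 A) (Omega L) _ _ _ h g f).

Lemma standard_lt3 X Y Z (f2 : closed_hom (loop Z) X 0) (f1 : closed_hom X Y 0)
    (f0 : closed_hom Y Z 0) X' Y' Z' (f2' : closed_hom (loop Z') X' 0)
    (f1' : closed_hom X' Y' 0) (f0' : closed_hom Y' Z' 0)
    (b : @pa_hom (H0 A) Y Y') (a : @pa_hom (H0 A) Z Z') :
  standard_left_triangle f2 f1 f0 -> standard_left_triangle f2' f1' f0' ->
  a \c cls f0 = (cls f0' : @pa_hom (H0 A) Y' Z') \c b ->
  exists c : @pa_hom (H0 A) X X',
    @triangle_morphism (H0 A) (Omega L) (Tri (cls f2) (cls f1) (cls f0))
      (Tri (cls f2') (cls f1') (cls f0')) c b a.
Proof.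
move=> /standard_left_triangleP[h [ex f2E]] /standard_left_triangleP[h' [ex' f2E']].
elim/H0_elim: b => b; elim/H0_elim: a => a sq; move: (sq).
rewrite /= !hocompE => /esym/cls0P[s sE].
have [c [cE cf2]] := standard_map ex f2E ex' f2E' (esym sE).
exists (cls c); split=> //=; rewrite !hocompE; apply/cls0P.
by case/fib_homotopic_sym: cE => x [_ [xE _]]; exists x.
Qed.

(** The given isomorphism leads to a standard triangle over another morphism. Its inverse on the two
    right objects extends to a map into a standard triangle on a kernel of [f], invertible by the
    five lemma; the composite is the identity on [Y] and [Z]. *)
Lemma left_triangles_standard Y Z X (h : @pa_hom (H0 A) (loop Z) X)
    (g : @pa_hom (H0 A) X Y) (f : closed_hom Y Z 0) :
  finitely_complete A -> left_triangles (Tri h g (cls f)) ->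
  exists K (f2 : closed_hom (loop Z) K 0) (f1 : closed_hom K Y 0)
    (c : @pa_hom (H0 A) X K),
    [/\ standard_left_triangle f2 f1 f, pa_iso c,
        c \c h = cls f2 & (cls f1 : @pa_hom (H0 A) K Y) \c c = g].
Proof.
move=> complete [A0 [A1 [A2 [f2' [f1' [f0' [st' [c [b [a [m ci bi ai]]]]]]]]]]].
have [K [f2 [f1 st]]] := standard_exists f complete.
have [[d [cK Kc]] [b' [bK Kb]] [a' [aK Ka]]] := And3 ci bi ai.
have [_ _ sq] := triangle_morphism_inv Omega_additive m cK Kc bK Kb aK Ka.
have [c' m'] := standard_lt3 st' st sq.
have c'i : pa_iso c'.
  apply: (exact_five Omega_additive (standard_exact st') (standard_exact st) m').
    by exists b.
  by exists a.
exists K, f2, f1, (c' \c c).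
have [mh mg _] := triangle_morphism_comp Omega_additive m' m.
split=> //; first exact: pa_iso_comp.
  have [Om_id _ _] := Omega_additive.
  by rewrite [LHS]mh aK Om_id pa_comp_id_r.
by rewrite -[LHS]mg bK pa_comp_id_l.
Qed.

(** Converse of [left_triangles_standard]; together they reduce membership in the class to an
    isomorphism of third objects. *)
Lemma left_triangles_over Y Z K X (f : closed_hom Y Z 0)
    (f2 : closed_hom (loop Z) K 0) (f1 : closed_hom K Y 0)
    (h : @pa_hom (H0 A) (loop Z) X) (g : @pa_hom (H0 A) X Y)
    (c : @pa_hom (H0 A) X K) :
  standard_left_triangle f2 f1 f -> pa_iso c ->
  c \c h = cls f2 -> (cls f1 : @pa_hom (H0 A) K Y) \c c = g ->
  left_triangles (Tri h g (cls f)).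
Proof.
move=> st ci ch gc; exists Z, Y, K, f2, f1, f; split=> //.
have [Om_id _ _] := Omega_additive.
exists c, (pa_id _), (pa_id _); split=> //; try exact: pa_iso_id.
by split; rewrite ?pa_comp_id_l // ?pa_comp_id_r // Om_id pa_comp_id_r.
Qed.

Lemma left_triangles_exact (T : triangle (Omega L)) :
  finitely_complete A -> left_triangles T -> exact_triangle T.
Proof.
move=> complete; case: T => Z Y X h g; elim/H0_elim => f.
move=> /(left_triangles_standard complete)[K [f2 [f1 [c [st ci ch gc]]]]].
exact: (exact_triangle_iso (Om := Omega L) (A := Z) ci ch gc (standard_exact st)).
Qed.

Lemma left_triangles_iso (S T : triangle (Omega L)) :
  triangle_iso S T -> left_triangles S -> left_triangles T.
Proof.
move=> ST [A0 [A1 [A2 [f2 [f1 [f0 [st iso]]]]]]].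
exists A0, A1, A2, f2, f1, f0; split=> //.
by have ? := triangle_iso_sym Omega_additive ST;
   apply: triangle_iso_trans iso; first exact: Omega_additive.
Qed.

(** * The axioms LT1 to LT4 *)

Section FinitelyComplete.
Variable complete : finitely_complete A.

(** The object [Omega Z] is zero because its identity is the image of [pa_id Z = 0]. Exactness then
    makes the kernel map [f1] of [0 : X -> Z] invertible, and its inverse compares the triangles. *)
Lemma left_triangles_lt1_id (Z X : H0 A) : zero_object Z ->
  left_triangles (@Triangle (H0 A) (Omega L) Z X X 0 (pa_id X) 0).
Proof.
move=> Z0; have OmZ0 W (x : @pa_hom (H0 A) W (Omega L Z)) : x = 0.
  have [Om_id _ _] := Omega_additive.
  have [idZ0 _] := Z0 Z.
  by rewrite -[x]pa_comp_id_l -Om_id (idZ0 (pa_id Z)) (functor0 Omega_additive)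
       pa_comp0l.
have [K [f2 [f1 st]]] := standard_exists (0 : closed_hom X Z 0) complete.
have ex := standard_exact st.
have f1_iso : @pa_iso (H0 A) K X (cls f1).
  apply: pa_iso_yoneda => W x.
    by move=> /(exact_at_C ex)[y <-]; rewrite (OmZ0 _ y) pa_comp0r.
  by apply: (exact_at_B ex); apply: (Z0 W).2.
have [g [gK Kg]] := f1_iso.
suff : left_triangles (@Triangle (H0 A) (Omega L) Z X X 0 (pa_id X)
    (cls (0 : closed_hom X Z 0))) by rewrite cls0.
apply: (left_triangles_over st (c := g)) => //.
  by exists (cls f1).
rewrite pa_comp0r.
transitivity ((cls f2 : @pa_hom (H0 A) (Omega L Z) K) \c pa_id (Omega L Z)).
  by rewrite (OmZ0 _ (pa_id (Omega L Z))) pa_comp0r.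
exact: pa_comp_id_r.
Qed.

Lemma left_triangles_lt1_ex (Y Z : H0 A) (f : pa_hom Y Z) :
  exists (D : H0 A) (h : pa_hom (Omega L Z) D) (g : pa_hom D Y),
    left_triangles (Triangle h g f).
Proof.
elim/H0_elim: f => f; have [K [f2 [f1 st]]] := standard_exists f complete.
exists K, (cls f2), (cls f1); apply: (left_triangles_over (c := pa_id (K : H0 A)) st).
- exact: pa_iso_id.
- exact: pa_comp_id_l.
- exact: pa_comp_id_r.
Qed.

Lemma left_triangles_lt2 (X Y D : H0 A) (h : pa_hom (Omega L X) D)
    (g : pa_hom D Y) (f : pa_hom Y X) :
  left_triangles (Triangle h g f) ->
  left_triangles (Triangle (- fmap (Omega L) f) h g).
Proof.

elim/H0_elim: f => f T.
have [F [f2 [f1 [c [st ci ch gc]]]]] := left_triangles_standard complete T.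
have [K [k2 [k1 stK]]] := standard_exists f1 complete.
have /standard_left_triangleP[hf [exF f2E]] := st.
have /standard_left_triangleP[hK [exK k2E]] := stK.
have [t [k1t tf]] := standard_rotation exF f2E exK k2E.
have t_iso : @pa_iso (H0 A) (loop X) K t.
  exact: (exact_rotation_iso Omega_additive (standard_exact st)
           (standard_exact stK) k1t tf).
apply: left_triangles_iso (left_triangles_over stK t_iso tf k1t).
have [c' [cK Kc]] := ci.
have c'f2 : c' \c (cls f2 : @pa_hom (H0 A) (loop X) F) = h.
  by rewrite -ch -pa_comp_assoc cK pa_comp_id_l.
have gc' : (g \c c') = cls f1 by rewrite -gc pa_comp_assoc Kc pa_comp_id_r.
have [Om_id _ _] := Omega_additive.
(* The kernel [F] of [f] is now the middle object, so the comparison [c'] sits in the second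
   position. *)
exists (pa_id _), c', (pa_id _); split; try exact: pa_iso_id; last by exists c.
split; first by rewrite Om_id pa_comp_id_l pa_comp_id_r.
  by rewrite pa_comp_id_r; exact: c'f2.
by rewrite pa_comp_id_l; exact: esym gc'.
Qed.

Lemma left_triangles_lt3 (S T : triangle (Omega L))
    (b : pa_hom (tri_B S) (tri_B T)) (a : pa_hom (tri_A S) (tri_A T)) :
  left_triangles S -> left_triangles T -> a \c tri_f S = tri_f T \c b ->
  exists c : pa_hom (tri_C S) (tri_C T), triangle_morphism c b a.
Proof.
case: S b a => Z Y X h g; elim/H0_elim => f b a.
case: T b a => Z' Y' X' h' g'; elim/H0_elim => f' b a.
move=> /(left_triangles_standard complete)[K [f2 [f1 [c [st ci ch gc]]]]].
move=> /(left_triangles_standard complete)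
  [K' [f2' [f1' [c' [st' [d [dK Kd]] ch' gc']]]]].
move=> sq; have [p m] := standard_lt3 st st' sq.
have [Om_id _ _] := Omega_additive.
have m1 : @triangle_morphism (H0 A) (Omega L) (Tri h g (cls f))
    (Tri (cls f2) (cls f1) (cls f)) c (pa_id _) (pa_id _).
  split; first by rewrite Om_id pa_comp_id_r; exact: ch.
    by rewrite pa_comp_id_l; exact: esym gc.
  by rewrite pa_comp_id_l pa_comp_id_r.
have m2 : @triangle_morphism (H0 A) (Omega L) (Tri (cls f2') (cls f1') (cls f'))
    (Tri h' g' (cls f')) d (pa_id _) (pa_id _).
  split; last by rewrite pa_comp_id_l pa_comp_id_r.
    rewrite Om_id pa_comp_id_r.
    have -> : tri_h (Tri (cls f2') (cls f1') (cls f')) = c' \c h' by exact: esym ch'.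
    by rewrite -pa_comp_assoc dK; exact: pa_comp_id_l.
  have -> : tri_g (Tri (cls f2') (cls f1') (cls f')) = g' \c d.
    by rewrite -gc' pa_comp_assoc Kd; exact: esym (pa_comp_id_r _).
  exact: pa_comp_id_l.
(* The comparisons with standard triangles are identities on the two right objects, so the composite
   still extends [b] and [a]. *)
exists (d \c (p \c c)).
have := triangle_morphism_comp Omega_additive m2
  (triangle_morphism_comp Omega_additive m m1).
by rewrite !pa_comp_id_l !pa_comp_id_r.
Qed.

(** The octahedron is formed on standard kernels [F0], [E0] and [D] and transported along [c] and
    [e]. What remains is to recognise [E -> D -> F] as a triangle, which holds because [p], from a
    kernel [K] of [u] to [E0], is invertible. *)
Lemma left_triangles_lt4 (Z Y X E F : H0 A)
    (f'' : pa_hom (Omega L Z) F) (f' : pa_hom F Y) (f : pa_hom Y Z)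
    (g'' : pa_hom (Omega L Y) E) (g' : pa_hom E X) (g : pa_hom X Y) :
  left_triangles (Triangle f'' f' f) -> left_triangles (Triangle g'' g' g) ->
  exists (D : H0 A)
    (v'' : pa_hom (Omega L Z) D) (v' : pa_hom D X)
    (u'' : pa_hom (Omega L F) E) (u' : pa_hom E D) (u : pa_hom D F),
    [/\ left_triangles (Triangle v'' v' (f \c g)),
        left_triangles (Triangle u'' u' u)
      & [/\ v' \c u' = g', f' \c u = g \c v', u \c v'' = f'',
            u'' = g'' \c fmap (Omega L) f'
          & u' \c g'' = v'' \c fmap (Omega L) f]].
Proof.
elim/H0_elim: f => f; elim/H0_elim: g => g.
move=> /(left_triangles_standard complete)[F0 [f2 [f1 [c [stf [c' [cK Kc]] ch gc]]]]].
move=> /(left_triangles_standard complete)[E0 [g2 [g1 [e [stg ei eh ge]]]]].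
pose fg := closed_comp (erefl : 0 = 0 + 0 :> int) f g.
have [D [v2 [v1 stv]]] := standard_exists fg complete.
have /standard_left_triangleP[hf [exF f2E]] := stf.
have /standard_left_triangleP[hg [exE g2E]] := stg.
have /standard_left_triangleP[hv [exD v2E]] := stv.
have [u [u' [[f1u uv2 v1u' u'g2 uu'] lift_p]]] :=
  standard_octahedron exF f2E exE g2E exD v2E.
have [K [k2 [k1 stu]]] := standard_exists u complete.
have /standard_left_triangleP[hK [exK k2E]] := stu.
have [p [pk2 u'p]] := lift_p _ _ _ _ exK k2E.
have rot (P Q R : A) (t2 : closed_hom (loop R) P 0) (t1 : closed_hom P Q 0)
    (t0 : closed_hom Q R 0) : standard_left_triangle t2 t1 t0 ->
    left_triangles (Tri (- fmap (Omega L) (cls t0 : @pa_hom (H0 A) Q R))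
      (cls t2 : @pa_hom (H0 A) (Omega L R) P) (cls t1)).
  move=> st; apply: left_triangles_lt2.
  apply: (left_triangles_over st) (pa_iso_id _) _ _.
    exact: pa_comp_id_l.
  exact: pa_comp_id_r.
(* Rotating once or twice by LT2 yields the exactness further to the left that the chase
   requires. *)
have p_iso : @pa_iso (H0 A) K E0 p.
  have ltE := left_triangles_exact complete.
  apply: (exact_octahedron_iso Omega_additive (ltE _ (rot _ _ _ _ _ _ stf))
    (ltE _ (left_triangles_lt2 (rot _ _ _ _ _ _ stf))) _ (standard_exact stg)
    _ (standard_exact stu) f1u uv2 v1u' u'g2 uu' pk2 u'p).
    by rewrite H0_compE; exact: ltE _ (rot _ _ _ _ _ _ stv).
  by rewrite H0_compE; exact: standard_exact stv.
have [q [qK Kq]] := p_iso.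
have [_ Om_comp _] := Omega_additive.
(* The classes are given their types as morphisms of [H0 A], so that the laws of composition there
   apply by rewriting. *)
pose F1 : @pa_hom (H0 A) F0 Y := cls f1;
pose F2 : @pa_hom (H0 A) (Omega L Z) F0 := cls f2.
pose G2 : @pa_hom (H0 A) (Omega L Y) E0 := cls g2.
pose V1 : @pa_hom (H0 A) D X := cls v1;
pose V2 : @pa_hom (H0 A) (Omega L Z) D := cls v2.
pose U : @pa_hom (H0 A) D F0 := cls u; pose U' : @pa_hom (H0 A) E0 D := u'.
pose P : @pa_hom (H0 A) K E0 := p.
pose K1 : @pa_hom (H0 A) K D := cls k1;
pose K2 : @pa_hom (H0 A) (Omega L F0) K := cls k2.
have c'F2 : c' \c F2 = f'' by rewrite /F2 -ch -pa_comp_assoc cK pa_comp_id_l.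
have f'c' : f' \c c' = F1 by rewrite -gc pa_comp_assoc Kc pa_comp_id_r.
have qG2 : q \c (G2 \c fmap (Omega L) F1) = K2.
  have <- : P \c K2 = G2 \c fmap (Omega L) F1 := pk2.
  by rewrite -pa_comp_assoc qK pa_comp_id_l.
have K1q : K1 \c q = U'.
  have <- : U' \c P = K1 := u'p.
  by rewrite pa_comp_assoc Kq pa_comp_id_r.
exists D, V2, V1, (g'' \c fmap (Omega L) f'), (U' \c e), (c' \c U); split.
- rewrite H0_compE.
  apply: (left_triangles_over (c := pa_id (D : H0 A)) stv) (pa_iso_id _) _ _.
    exact: pa_comp_id_l.
  exact: pa_comp_id_r.
- exists F0, D, K, k2, k1, u; split=> //.
  (* The third object goes [E -> E0 -> K], with [q] the inverse of [p]; the right object [F] goes to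
     [F0] by [c], so [Omega c] enters the leftmost square. *)
  exists (q \c e), (@pa_id (H0 A) D), c; split; first split.
  + transitivity (q \c (e \c (g'' \c fmap (Omega L) f'))); first exact: pa_comp_assoc.
    rewrite -(pa_comp_assoc e) eh -gc Om_comp.
    transitivity (q \c (G2 \c fmap (Omega L) F1) \c fmap (Omega L) c).
      by rewrite !pa_comp_assoc.
    by rewrite qG2.
  + rewrite pa_comp_id_l; transitivity (K1 \c q \c e); first by rewrite K1q.
    exact: pa_comp_assoc.
  + rewrite pa_comp_id_r; transitivity (c \c c' \c U).
      exact: esym (pa_comp_assoc _ _ _).
    by rewrite Kc pa_comp_id_l.
  + by apply: pa_iso_comp ei; exists p.
  + exact: pa_iso_id.
  + by exists c'.
- split=> //.
  + rewrite -pa_comp_assoc -ge; congr (_ \c _); exact: v1u'.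
  + rewrite -pa_comp_assoc f'c'; exact: f1u.
  + rewrite pa_comp_assoc -c'F2; congr (_ \c _); exact: uv2.
  + rewrite pa_comp_assoc eh; exact: u'g2.
Qed.

End FinitelyComplete.
End Standard.

Theorem proposition2p17 (k : comPzRingType) (A : dg_category k)
    (A_nonpositive : nonpositive A) (A_complete : finitely_complete A)
    (L : forall X : A, loop_object X) :
  left_triangulated (@left_triangles k A L).
Proof.
split.
- exact: A_complete.1.
- exact: Omega_additive.
- exact: left_triangles_iso.
- by move=> Z X; exact: left_triangles_lt1_id.
- by move=> Y Z f; exact: left_triangles_lt1_ex.
- by move=> X Y D h g f; exact: left_triangles_lt2.
- by move=> S T b a; exact: left_triangles_lt3.
- by move=> Z Y X E F f'' f' f g'' g' g; exact: left_triangles_lt4.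
Qed.
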